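(* It is decidable, given a mixing subshift of finite type $X$ (presented by a finite alphabet and a finite set of forbidden words) and a cellular automaton $f : X \to X$ (presented by a local rule), whether $f$ is (Von Neumann) regular as an element of the monoid $\mathrm{End}(X)$.
   Context: For a finite alphabet $\Sigma$, the full shift $\Sigma^{\mathbb{Z}}$ carries the product topology and the shift map $\sigma(x)_i = x_{i+1}$. A subshift is a closed shift-invariant subset of a full shift; it is of finite type (an SFT) if it is defined by a finite set of forbidden words. The language of a subshift is the set of words appearing in its configurations. A subshift $X$ is mixing if for all words $u,v$ in the language of $X$, for all large enough $n$ there is a word $w$ with $|w|=n$ such that $uwv$ is in the language of $X$. A cellular automaton on $X$ is a continuous shift-commuting function $f : X \to X$; equivalently, there are a radius $r \in \mathbb{N}$ and a local rule such that $f(x)_i$ is determined by $x|_{[i-r,i+r]}$ via the local rule, for all $x \in X$ and $i \in \mathbb{Z}$. The cellular automata on $X$ form a monoid $\mathrm{End}(X)$ under composition. An element $a$ of a semigroup $S$ is (Von Neumann) regular if there is $b \in S$ such that $aba = a$ and $bab = b$. *)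

(* Defs.v *)
From HB Require Import structures.
From mathcomp Require Import all_boot all_order all_algebra.
From mathcomp Require Import all_classical.
From mathcomp Require Import topology.

Set Implicit Arguments.
Unset Strict Implicit.
Unset Printing Implicit Defensive.

Import GRing.Theory.

Local Open Scope classical_set_scope.
Local Open Scope ring_scope.

(* The alphabet is {0, ..., k-1}, without loss of generality. *)
Notation config k :=
  (prod_topology (fun _ : int => discrete_topology (ordinal k))).

Definition shift_map (k : nat) (x : config k) : config k := fun i => x (i + 1).

Record subshift (k : nat) := Subshift {
  subshift_set :> set (config k);
  subshift_closed : closed subshift_set;
  subshift_invariant : shift_map (k:=k) @` subshift_set = subshift_set
}.

Definition word_at (k : nat) (x : config k) (i : int) (n : nat) : seq 'I_k :=
  [seq x (i + j%:Z) | j <- iota 0 n].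

Definition appears (k : nat) (w : seq 'I_k) (x : config k) : Prop :=
  exists i : int, word_at x i (size w) = w.

Definition language (k : nat) (X : set (config k)) : set (seq 'I_k) :=
  [set w | exists2 x, X x & appears w x].

Definition mixing (k : nat) (X : subshift k) : Prop :=
  forall u v, language X u -> language X v ->
  exists N : nat, forall n : nat, (N <= n)%N ->
  exists2 w, size w = n & language X (u ++ w ++ v).

Definition avoiding (k : nat) (F : seq (seq 'I_k)) : set (config k) :=
  [set x | forall w, w \in F -> ~ appears w x].

Lemma avoiding_closed (k : nat) (F : seq (seq 'I_k)) : closed (avoiding F).
Proof.
move=> x clx w Fw [i wx].
have nx n : \forall y \near x, word_at y i n = word_at x i n.
  elim: n => [|n IHn]; first exact: filterE.
  have cn := @proj_continuous int
    (fun=> discrete_topology (ordinal k) : topologicalType) (i + n%:Z) x.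
  have := cn _ (discrete_set1 _) => /= xn.
  apply: filterS2 IHn xn => y /= yx yxn.
  rewrite /word_at -addn1 iotaD !map_cat /= add0n.
  by congr (_ ++ [:: _]); [exact: yx|exact: yxn].
have [y [Fy yx]] := clx _ (nx (size w)).
by apply: (Fy w Fw); exists i; rewrite yx.
Qed.

Lemma avoiding_invariant (k : nat) (F : seq (seq 'I_k)) :
  shift_map (k:=k) @` avoiding F = avoiding F.
Proof.
apply/seteqP; split=> [_ [x Fx <-] w Fw [i wx]|x Fx].
  apply: (Fx w Fw); exists (i + 1); rewrite -[RHS]wx.
  by apply: eq_map => j; rewrite /shift_map addrAC.
exists (fun i => x (i - 1)); last first.
  by apply/funext => i; rewrite /shift_map addrK.
move=> w Fw [i wx]; apply: (Fx w Fw); exists (i - 1); rewrite -[RHS]wx.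
by apply: eq_map => j; rewrite addrAC.
Qed.

Definition sft (k : nat) (F : seq (seq 'I_k)) : subshift k :=
  Subshift (@avoiding_closed k F) (@avoiding_invariant k F).

Lemma shift_mem (k : nat) (X : subshift k) (x : X) :
  shift_map (val x) \in subshift_set X.
Proof.
apply: mem_set; have /seteqP[sX _] := subshift_invariant X.
by apply: sX; exists (val x) => //; exact: set_valP.
Qed.

Definition shift_on (k : nat) (X : subshift k) (x : X) : X :=
  SigSub (shift_mem x).

(* Continuity is with respect to the topology induced on [X] by the product
   topology. *)
Record End (k : nat) (X : subshift k) := CellularAutomaton {
  ca_fun :> X -> X;
  ca_continuous : continuous ca_fun;
  ca_shift : forall x : X, ca_fun (shift_on x) = shift_on (ca_fun x)
}.

Section EndMonoid.
Variables (k : nat) (X : subshift k).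

Lemma End_eq (f g : End X) : f =1 g -> f = g.
Proof.
case: f g => [f cf sf] [g cg sg] /= /funext fg; case: _ / fg in cg sg *.
by congr CellularAutomaton; exact: Prop_irrelevance.
Qed.

Lemma End_id_continuous : continuous (@id X).
Proof. by move=> x. Qed.

Definition End_id : End X :=
  @CellularAutomaton k X id End_id_continuous (fun=> erefl).

Lemma End_comp_continuous (f g : End X) : continuous (f \o g).
Proof. by move=> x; apply: continuous_comp; apply: ca_continuous. Qed.

Lemma End_comp_shift (f g : End X) (x : X) :
  (f \o g) (shift_on x) = shift_on ((f \o g) x).
Proof. by rewrite /= !ca_shift. Qed.

Definition End_comp (f g : End X) : End X :=
  CellularAutomaton (@End_comp_continuous f g) (@End_comp_shift f g).

Lemma End_compA : associative End_comp.
Proof. by move=> f g h; apply: End_eq. Qed.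

Lemma End_comp1f : left_id End_id End_comp.
Proof. by move=> f; apply: End_eq. Qed.

Lemma End_compf1 : right_id End_id End_comp.
Proof. by move=> f; apply: End_eq. Qed.

HB.instance Definition _ := gen_eqMixin (End X).
HB.instance Definition _ := gen_choiceMixin (End X).
HB.instance Definition _ :=
  isMonoid.Build (End X) End_compA End_comp1f End_compf1.

End EndMonoid.

Definition vn_regular (S : semigroupType) (a : S) : Prop :=
  exists b : S, (a * b * a)%g = a /\ (b * a * b)%g = b.

(* The rule is a total table: its entries at words that do not occur in [X] are
   unconstrained. *)
Definition has_local_rule (k : nat) (X : subshift k) (f : End X) (r : nat)
    (phi : {ffun r.*2.+1.-tuple 'I_k -> 'I_k}) : Prop :=
  forall (x : X) (i : int),
  val (f x) i = phi [tuple val x (i - r%:Z + j%:Z) | j < r.*2.+1].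

(* Partial recursive functions of [n] arguments. *)
Inductive recfun : nat -> Type :=
| Zero n : recfun n
| Succ : recfun 1
| Proj n (i : 'I_n) : recfun n
| Comp m n (g : recfun m) (h : 'I_m -> recfun n) : recfun n
| PrimRec n (g : recfun n) (h : recfun n.+2) : recfun n.+1
| Mu n (g : recfun n.+1) : recfun n.

(* [computes p v y]: the partial function [p] is defined at [v], with value [y].
   In the [PrimRec] case, [s] lists the successive values of the recursion. *)
Fixpoint computes (n : nat) (p : recfun n) : n.-tuple nat -> nat -> Prop :=
  match p in recfun n return n.-tuple nat -> nat -> Prop with
  | Zero _ => fun _ y => y = 0%N
  | Succ => fun v y => y = (thead v).+1
  | Proj _ i => fun v y => y = tnth v i
  | Comp m _ g h => fun v y => exists2 w : m.-tuple nat,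
      forall i, computes (h i) v (tnth w i) & computes g w y
  | PrimRec _ g h => fun v y => exists s : nat -> nat,
      [/\ computes g (behead_tuple v) (s 0%N),
          forall i, (i < thead v)%N ->
            computes h [tuple of i :: s i :: behead_tuple v] (s i.+1)
        & y = s (thead v)]
  | Mu _ g => fun v y =>
      computes g [tuple of y :: v] 0%N /\
      forall i, (i < y)%N -> exists z, computes g [tuple of i :: v] z.+1
  end.

Lemma computes_functional (n : nat) (p : recfun n) (v : n.-tuple nat)
  (y z : nat) : computes p v y -> computes p v z -> y = z.
Proof.
elim: p v y z => {n} [n|| n i|m n g IHg h IHh|n g IHg h IHh|n g IHg] v y z /=;
  do ?by move=> -> ->.
- move=> [w hw gw] [w' hw' gw']; suff e : w = w' by apply: (IHg w); rewrite // e.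
  by apply: eq_from_tnth => i; apply: (IHh i v).
- move=> [s [s0 sS ->]] [t [t0 tS ->]].
  suff e i : (i <= thead v)%N -> s i = t i by exact: e.
  elim: i => [_|i IHi iv]; first exact: IHg s0 t0.
  by apply: IHh (sS i iv) _; rewrite (IHi (ltnW iv)); exact: tS.
move=> [gy my] [gz mz]; case: (ltngtP y z) => // [yz|zy].
  by have [u gu] := mz y yz; have := IHg _ _ _ gy gu.
by have [u gu] := my z zy; have := IHg _ _ _ gz gu.
Qed.

Definition decides_at (n : nat) (p : recfun n) (v : n.-tuple nat) (P : Prop) :=
  (P -> computes p v 1%N) /\ (~ P -> computes p v 0%N).

(* [CodeSeq.code] is a recursive bijection from [seq nat] to [nat]. *)
Definition code_words (k : nat) (s : seq (seq 'I_k)) : nat :=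
  CodeSeq.code [seq CodeSeq.code [seq val a | a <- w] | w <- s].

(* The graph of a local rule, each row being an argument followed by the
   corresponding value. *)
Definition rule_table (k r : nat) (phi : {ffun r.*2.+1.-tuple 'I_k -> 'I_k}) :
    seq (seq 'I_k) :=
  [seq rcons t (phi t) | t : r.*2.+1.-tuple 'I_k].

Definition instance_code (k : nat) (F : seq (seq 'I_k)) (r : nat)
    (phi : {ffun r.*2.+1.-tuple 'I_k -> 'I_k}) : 4.-tuple nat :=
  [tuple k; code_words F; r; code_words (rule_table phi)].

(* Main.v *)
Require Import Defs.
From mathcomp Require Import all_boot all_order all_algebra.
From mathcomp Require Import all_classical.
From mathcomp Require Import topology.
From mathcomp Require Import zify.

(** Regularity of [f] means that some cellular automaton [g] satisfies
    [f g f = f], that is, [g] picks preimages on the image of [f].  Present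
    the SFT as the bi-infinite paths of a graph on the words of a fixed length,
    each vertex carrying the letter that [f] writes there, and let the relation
    of a word be the set of pairs of vertices joined by a path with that label.

    For words [u] with idempotent relation, let [G u] be the vertex at the origin
    of [g] applied to the periodic configuration of period [u].  Applying [g] to
    [...uuu w vvv...] shows that [G u] and [G v] are joined by a path labelled
    [u w v] as soon as some pair of vertices is.  So regularity yields tables [G]
    for every bound on the lengths of the words.

    Conversely, tables yield [g].  Cut a configuration at every position of a
    long periodic stretch, and elsewhere near the strict local maxima of the rank
    of a long block; by Ramsey's theorem, next to each maximum there are adjacent
    words [u], [u'] such that [u], [u'] and [uu'] have the same idempotent relation,
    and the cut is made between them.  Put [G (uu')] at the cut.  A segment
    between consecutive cuts then has the relation of [u w v] with [u], [v] the
    words at its ends, so it can be filled in, independently of the others;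
    outside the image of [f], mixing fills it in.

    Tables for one bound are a finite object, so their absence for some bound is
    semi-decidable; by compactness, so is the existence of a local rule of [g].
    Searching for either witness decides regularity. *)

Set Implicit Arguments.
Unset Strict Implicit.
Unset Printing Implicit Defensive.
Import Order.TTheory GRing.Theory Num.Theory.

(** * Relations labelled by words *)

(** Induction on the number of colours allowed. Many elements above the least one [a] see the same
    colour [d] from [a]. Either some pair of them has colour [d] too, which closes a triangle, or
    [d] never occurs among them and one colour is lost. *)
Lemma ramsey_triangle_aux (C : finType) (n : nat) : exists L : nat,
  forall (D : {set C}) (chi : nat -> nat -> C) (s : seq nat),
    (#|D| <= n)%N -> sorted ltn s -> (L <= size s)%N ->
    (forall a b, a \in s -> b \in s -> (a < b)%N -> chi a b \in D) ->
  exists a b c, [/\ (a < b)%N, (b < c)%N, a \in s, b \in s & c \in s] /\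
    chi a b = chi b c /\ chi a b = chi a c.
Proof.
elim: n => [|n [L IHn]].
  exists 2 => D chi [|a [|b s]] //; rewrite leqn0 cards_eq0 => /eqP -> /= /andP[ab _] _.
  by move=> /(_ a b); rewrite !inE !eqxx orbT ab => /(_ isT isT isT).
(* One element for [a] and more than [n.+1 * L] others, so that one of at most [n.+1] colour classes
   has at least [L] elements. *)
exists (n.+1 * L).+2 => D chi [|a s] // leD /= pas.
rewrite ltnS => leL chiD.
have ls : sorted ltn s by apply: path_sorted pas.
have als b : b \in s -> (a < b)%N.
  by move=> bs; have /allP/(_ b bs) := order_path_min ltn_trans pas.
have [[d dD Ld]|noD] := pselect (exists2 d, d \in D &
    (L <= size [seq b <- s | chi a b == d])%N); last first.
  exfalso; have: (size s <= \sum_(d in D) L)%N.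
    rewrite -[X in (X <= _)%N](_ : \sum_(d in D)
       size [seq b <- s | chi a b == d] = _).
      apply: leq_sum => d dD; rewrite leqNgt; apply/negP => lt.
      by apply: noD; exists d => //; apply: ltnW.
    under eq_bigr do rewrite size_filter -sum1_count big_mkcond /=.
    rewrite exchange_big /= -sum1_size big_seq [RHS]big_seq.
    apply: eq_bigr => b bs; rewrite (bigD1 (chi a b)) /=; last first.
      by apply: chiD; rewrite ?inE ?eqxx ?bs ?orbT ?als.
    rewrite eqxx big1 // => d /andP[_]; rewrite eq_sym; by case: eqP.
  rewrite sum_nat_const => le2.
  have := leq_trans leL (leq_trans le2 (leq_mul leD (leqnn L))).
  by rewrite ltnn.
set t := [seq b <- s | chi a b == d] in Ld.
have ts b : b \in t -> b \in s by rewrite mem_filter => /andP[].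
have td b : b \in t -> chi a b = d by rewrite mem_filter => /andP[/eqP].
have lt : sorted ltn t by apply: sorted_filter => //; apply: ltn_trans.
have [[b [c [bt [ct [bc e]]]]]|nobc] := pselect (exists b c,
    b \in t /\ c \in t /\ (b < c)%N /\ chi b c = d).
  exists a, b, c; split; last by rewrite (td b bt) (td c ct) e.
  by rewrite !inE eqxx (ts _ bt) (ts _ ct) !orbT bc; split => //; apply/als/ts.
have [|||a' b' a't b't a'b'|a' [b' [c' [[ab' bc' at' bt' ct'] e]]]] :=
    IHn (D :\ d) chi t.
- by move: leD; rewrite (cardsD1 d D) dD.
- by [].
- exact: Ld.
- rewrite !inE chiD ?andbT; last by [].
  + by apply/eqP => e; apply: nobc; exists a', b'; do !split.
  + by rewrite inE ts ?orbT.
  + by rewrite inE ts ?orbT.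
exists a', b', c'; rewrite !inE !ts ?orbT //.
Qed.

Lemma ramsey_triangle (C : finType) : exists L : nat,
  forall chi : nat -> nat -> C, exists a b c,
  [/\ (a < b)%N, (b < c)%N, (c <= L)%N, chi a b = chi b c & chi a b = chi a c].
Proof.
have [L HL] := ramsey_triangle_aux C #|C|; exists L => chi.
have [||||a [b [c [[ab bc _ _ cL] [e1 e2]]]]] := HL [set: C] chi (iota 0 L).
- by rewrite cardsT.
- exact: iota_ltn_sorted.
- by rewrite size_iota.
- by move=> *; rewrite inE.
exists a, b, c; split => //.
by move: cL; rewrite mem_iota => /andP[_ /ltnW].
Qed.

Section Relations.
Variable S : finType.

Definition relcomp (r1 r2 : {set S * S}) : {set S * S} :=
  [set st | [exists q, ((st.1, q) \in r1) && ((q, st.2) \in r2)]].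

Lemma relcompP (r1 r2 : {set S * S}) s t :
  reflect (exists2 q, (s, q) \in r1 & (q, t) \in r2) ((s, t) \in relcomp r1 r2).
Proof.
rewrite inE /=; apply: (iffP existsP) => [[q /andP[]]|[q h1 h2]]; exists q => //.
by rewrite h1.
Qed.

Lemma relcompA : associative relcomp.
Proof.
move=> a b c; apply/setP => -[s t]; apply/relcompP/relcompP.
  by move=> [q sq /relcompP[q' h1 h2]]; exists q' => //; apply/relcompP; exists q.
by move=> [q /relcompP[q' h1 h2] sq]; exists q' => //; apply/relcompP; exists q.
Qed.

Definition inhab (r : {set S * S}) : bool := [exists st, st \in r].

Lemma inhabP (r : {set S * S}) : reflect (exists s t, (s, t) \in r) (inhab r).
Proof.
apply: (iffP existsP) => [[[s t] st]|[s [t st]]]; first by exists s, t.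
by exists (s, t).
Qed.

Fixpoint relpow (r : {set S * S}) (n : nat) : {set S * S} :=
  if n is n'.+1 then relcomp r (relpow r n') else [set st | st.1 == st.2].

Lemma relcomp1r (r : {set S * S}) : relcomp [set st | st.1 == st.2] r = r.
Proof.
apply/setP => -[s t]; apply/relcompP/idP => [[q]|st].
  by rewrite inE /= => /eqP ->.
by exists s => //; rewrite inE.
Qed.

Lemma relcompr1 (r : {set S * S}) : relcomp r [set st | st.1 == st.2] = r.
Proof.
apply/setP => -[s t]; apply/relcompP/idP => [[q qr]|st].
  by rewrite inE /= => /eqP <-.
by exists t => //; rewrite inE.
Qed.

Lemma relpowD r m n : relpow r (m + n) = relcomp (relpow r m) (relpow r n).
Proof.
by elim: m => [|m IHm]; rewrite ?relcomp1r //= IHm relcompA.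
Qed.

Lemma relpow_idem_mul r m n : (0 < n)%N ->
  relcomp (relpow r m) (relpow r m) = relpow r m -> relpow r (m * n) = relpow r m.
Proof.
move=> n0 e; case: n n0 => // n _; elim: n => [|n IHn]; first by rewrite muln1.
by rewrite mulnS relpowD IHn.
Qed.

(** Colour [(i, j)] by the power [j - i] of [r]: a monochromatic triangle yields an idempotent power
    of exponent at most [L]. The factorial of [L] is a multiple of this exponent for all [r] at
    once, and an idempotent equals its positive powers. *)
Lemma relpow_idem_exponent : exists2 m : nat, (0 < m)%N &
  forall r, relcomp (relpow r m) (relpow r m) = relpow r m.
Proof.
have [L HL] := ramsey_triangle {set S * S}.
exists L`! => [|r]; first exact: fact_gt0.
have [a [b [c [ab bc cL e1 e2]]]] := HL (fun i j => relpow r (j - i)).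
have id : relcomp (relpow r (b - a)) (relpow r (b - a)) = relpow r (b - a).
  rewrite {2}e1 -relpowD.
  have -> : (b - a + (c - b) = c - a)%N by lia.
  by rewrite e2.
have /dvdnP[q ->] : (b - a %| L`!)%N by rewrite dvdn_fact //; lia.
have [->|q0] := posnP q; first by rewrite /= relcomp1r.
by rewrite mulnC relpow_idem_mul.
Qed.

End Relations.

Section LabelledGraph.
Variables (S A : finType) (E : rel S) (lam : S -> A).

(** An edge carries the label of its source, so a walk reading a word of length [n] has [n + 1]
    vertices and the label of the last one is free. *)
Definition step (a : A) : {set S * S} :=
  [set st | E st.1 st.2 && (lam st.1 == a)].

Fixpoint rlab (w : seq A) : {set S * S} :=
  if w is a :: w' then relcomp (step a) (rlab w') else [set st | st.1 == st.2].

Lemma rlab_cat u v : rlab (u ++ v) = relcomp (rlab u) (rlab v).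
Proof. by elim: u => [|a u IHu] /=; rewrite ?relcomp1r // IHu relcompA. Qed.

Lemma rlab1 a : rlab [:: a] = step a.
Proof. exact: relcompr1. Qed.

Definition walk (n : nat) (s t : S) (q : nat -> S) : Prop :=
  [/\ q 0%N = s, q n = t & forall i, (i < n)%N -> E (q i) (q i.+1)].

Definition lwalk (w : seq A) (s t : S) (q : nat -> S) : Prop :=
  walk (size w) s t q /\
  forall i a, (i < size w)%N -> lam (q i) = nth a w i.

Lemma rlabP w s t : (s, t) \in rlab w <-> exists q, lwalk w s t q.
Proof.
elim: w s => [|a w IHw] s /=; split.
- by rewrite inE /= => /eqP ->; exists (fun=> t); split => //.
- by move=> [q [[<- <- _] _]]; rewrite inE.
- move=> /relcompP[s']; rewrite inE /= => /andP[Es /eqP ls] /IHw[q [[q0 qn Eq] lq]].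
  exists (fun i => if i is i'.+1 then q i' else s); split; first split => //.
  + by case=> [_|i /Eq] //; rewrite q0.
  + by case=> [|i] b //= iw; exact: lq.
- move=> [q [[q0 qn Eq] lq]]; apply/relcompP; exists (q 1%N).
    by rewrite inE /= -q0 Eq //= (lq 0%N a) /=.
  apply/IHw; exists (q \o succn); split; first split => //= i iw.
    exact: Eq.
  by move=> i b iw; apply: (lq i.+1 b).
Qed.

Definition idem_word (u : seq A) : bool :=
  relcomp (rlab u) (rlab u) == rlab u.

(** All positive powers of such a word have the same inhabited relation, so the periodic
    configuration it generates labels a bi-infinite path. *)
Definition good_word (u : seq A) : bool :=
  [&& (0 < size u)%N, idem_word u & inhab (rlab u)].

(* [G u] is the vertex to be placed at a cut whose surroundings read [u].  The
   second clause lets neighbouring cuts of a periodic stretch, whose words are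
   rotations of each other, be joined by a single edge. *)
Definition section_table (P : nat) (G : seq A -> S) : Prop :=
  (forall u w v, good_word u -> good_word v ->
     (size u <= P)%N -> (size w <= P)%N -> (size v <= P)%N ->
     inhab (rlab (u ++ w ++ v)) -> (G u, G v) \in rlab (u ++ w ++ v)) /\
  (forall a w, good_word (a :: w) -> good_word (rcons w a) ->
     (size w < P)%N -> (G (a :: w), G (rcons w a)) \in step a).

End LabelledGraph.

(** * Markers and the lift of a labelled graph *)

Section Local.
Variable T : Type.
Local Open Scope ring_scope.

Definition shift (j : int) (p : int -> T) : int -> T := fun i => p (i + j).

Lemma shift0 p : shift 0 p = p.
Proof. by apply/funext => i; rewrite /shift addr0. Qed.

Lemma shiftD i j p : shift i (shift j p) = shift (i + j) p.
Proof. by apply/funext => k; rewrite /shift addrA. Qed.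

Definition agree (n : nat) (p p' : int -> T) : Prop :=
  forall i : int, (`|i| <= n)%N -> p i = p' i.

Lemma agree_le m n p p' : (m <= n)%N -> agree n p p' -> agree m p p'.
Proof. by move=> mn pp' i im; apply: pp'; exact: leq_trans mn. Qed.

(** The closure properties below show that a function is a local rule without computing its
    radius. *)
Definition locl (X : Type) (f : (int -> T) -> X) : Prop :=
  exists n, forall p p', agree n p p' -> f p = f p'.

Lemma locl_const X (x : X) : locl (fun=> x).
Proof. by exists 0%N. Qed.

Lemma locl_eval i : locl (fun p => p i).
Proof. by exists `|i|%N => p p'; apply. Qed.

Lemma locl_comp X Y (F : X -> Y) f : locl f -> locl (fun p => F (f p)).
Proof. by move=> [n fn]; exists n => p p' /fn ->. Qed.

Lemma locl_comp2 X Y W (F : X -> Y -> W) f g :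
  locl f -> locl g -> locl (fun p => F (f p) (g p)).
Proof.
move=> [n fn] [n' gn]; exists (maxn n n') => p p' pp'.
rewrite (fn p p') 1?(gn p p') //; apply: agree_le pp'; lia.
Qed.

Lemma locl_shift X (f : _ -> X) j : locl f -> locl (fun p => f (shift j p)).
Proof.
move=> [n fn]; exists (n + `|j|)%N => p p' pp'; apply: fn => i im.
by apply: pp'; lia.
Qed.

Lemma locl_if X (b : (int -> T) -> bool) (f g : _ -> X) :
  locl b -> locl f -> locl g -> locl (fun p => if b p then f p else g p).
Proof.
move=> lb lf lg; apply: (locl_comp2 (fun (b : bool) (h : bool -> X) => h b)
  (g := fun p b => if b then f p else g p)) => //.
exact: (locl_comp2 (fun x y (b : bool) => if b then x else y) lf lg).
Qed.

Lemma locl_map I X (F : I -> (int -> T) -> X) (s : seq I) :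
  (forall i, locl (F i)) -> locl (fun p => [seq F i p | i <- s]).
Proof.
move=> lF; elim: s => [|i s IHs]; first exact: locl_const.
exact: (locl_comp2 cons (lF i) IHs).
Qed.

Lemma locl_all I (P : I -> (int -> T) -> bool) (s : seq I) :
  (forall i, locl (P i)) -> locl (fun p => all (P^~ p) s).
Proof.
move=> lP; have [n ln] := locl_comp (all id) (locl_map s lP); exists n => p p' /ln.
by rewrite !all_map.
Qed.

Lemma locl_has I (P : I -> (int -> T) -> bool) (s : seq I) :
  (forall i, locl (P i)) -> locl (fun p => has (P^~ p) s).
Proof.
move=> lP; have [n ln] := locl_comp (has id) (locl_map s lP); exists n => p p' /ln.
by rewrite !has_map.
Qed.

Lemma locl_find I (P : I -> (int -> T) -> bool) (s : seq I) :
  (forall i, locl (P i)) -> locl (fun p => find (P^~ p) s).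
Proof.
move=> lP; have [n ln] := locl_comp (find id) (locl_map s lP); exists n => p p' /ln.
by rewrite !find_map.
Qed.

(** Each [F i] has its own radius; since the index stays below [N], the largest of the first [N]
    radii serves. *)
Lemma locl_dep X (N : nat) (d : (int -> T) -> nat) (F : nat -> _ -> X) :
  locl d -> (forall p, (d p < N)%N) -> (forall i, locl (F i)) ->
  locl (fun p => F (d p) p).
Proof.
move=> [n dn] dN lF.
have [n' Fn] : exists n', forall i p p', (i < N)%N -> agree n' p p' ->
    F i p = F i p'.
  elim: {dN} N => [|N [n' IHN]]; first by exists 0%N.
  have [n1 Fn] := lF N; exists (maxn n' n1) => i p p'.
  rewrite ltnS leq_eqVlt => /orP[/eqP ->|iN] pp'.
    by apply: Fn; apply: agree_le pp'; lia.
  by apply: IHN => //; apply: agree_le pp'; lia.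
exists (maxn n n') => p p' pp'; rewrite (dn p p'); last first.
  by apply: agree_le pp'; lia.
by apply: Fn => //; apply: agree_le pp'; lia.
Qed.

End Local.

Lemma period_chain (T : Type) (p : int -> T) (lo hi : int) (d n : nat) (i : int) :
  (forall i : int, (lo <= i -> i + d%:Z < hi -> p i = p (i + d%:Z))%R) ->
  (lo <= i -> i + (n * d)%N%:Z < hi -> p i = p (i + (n * d)%N%:Z))%R.
Proof.
move=> pd li; elim: n => [|n IHn] ih; first by rewrite mul0n addr0.
rewrite IHn; last by lia.
rewrite pd; [|lia|lia]; congr p; lia.
Qed.

Section Words.
Variables (S A : Type) (pi : S -> A).
Local Open Scope ring_scope.

Definition pword (p : int -> S) (i : int) (n : nat) : seq A :=
  [seq pi (p (i + j%:Z)) | j <- iota 0 n].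

Lemma pword_shift p c i n : pword (shift c p) i n = pword p (i + c) n.
Proof. by apply: eq_map => j; rewrite /shift addrAC. Qed.

Lemma size_pword p i n : size (pword p i n) = n.
Proof. by rewrite size_map size_iota. Qed.

Lemma nth_pword a p i n j : (j < n)%N -> nth a (pword p i n) j = pi (p (i + j%:Z)).
Proof. by move=> jn; rewrite (nth_map 0%N) ?size_iota // nth_iota. Qed.

Lemma pword_cat p i n n' : pword p i (n + n') = pword p i n ++ pword p (i + n%:Z) n'.
Proof.
rewrite /pword iotaD map_cat add0n -[X in iota X n']addn0 iotaDl -map_comp.
by congr (_ ++ _); apply: eq_map => j /=; rewrite PoszD addrA.
Qed.

Lemma eq_pword p i i' n :
  (forall j : nat, (j < n)%N -> p (i + j%:Z) = p (i' + j%:Z)) ->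
  pword p i n = pword p i' n.
Proof.
move=> pp'; apply/eq_in_map => j; rewrite mem_iota => /andP[_ jn].
by rewrite pp'.
Qed.

Lemma locl_pword i n : locl (fun p => pword p i n).
Proof. by apply: locl_map => j; exact/locl_comp/locl_eval. Qed.

End Words.

Section LabelledPaths.
Variables (S : Type) (A : finType) (pi : S -> A).
Local Open Scope ring_scope.

Lemma rl_path (T : finType) (E : rel T) (lam : T -> A) p (p' : int -> T) i n :
  (forall i, E (p' i) (p' (i + 1))) -> (forall i, lam (p' i) = pi (p i)) ->
  (p' i, p' (i + n%:Z)) \in rlab E lam (pword pi p i n).
Proof.
move=> Ep' lp'; apply/rlabP; exists (fun j => p' (i + j%:Z)); split; first split.
- by rewrite addr0.
- by rewrite size_pword.
- by move=> j _; rewrite -addn1 PoszD addrA.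
- by move=> j a; rewrite size_pword => jn; rewrite lp' nth_pword.
Qed.

End LabelledPaths.

(** * Cutting a configuration at markers and in periodic stretches *)

Section Cuts.
Variables (S A : finType) (E : rel S) (lam pi : S -> A).
(** [L] is the Ramsey bound, [D] the distance separating markers, [Q] the common period, [m] an
    exponent making all powers idempotent, [QM] the length of a context in a periodic stretch, [N0]
    the mixing time, [M2] the distance from good markers to periodic stretches, [H] half the width
    of the window. *)
Variables (G : seq A -> S) (L D Q m QM N0 M2 H : nat).
Local Open Scope ring_scope.
Notation conf := (int -> S).
Notation rl := (rlab E lam).
Notation pword := (pword pi).

(* [Q] will be a multiple of all numbers up to [D]: a common period spares
   comparing the least periods of overlapping windows. *)
Definition periodic_at (p : conf) : bool :=
  all (fun j : nat => p (j%:Z - H%:Z) == p (j%:Z - H%:Z + Q%:Z))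
      (iota 0 (H.*2 - Q)).

Definition block (p : conf) : {ffun 'I_(H.*2) -> S} :=
  [ffun j : 'I_(H.*2) => p (j%:Z - H%:Z)].

Definition rank (p : conf) : nat := enum_rank (block p).

(* A tie of ranks at distance [d <= D] makes the block periodic of period [d], so
   following larger and larger ranks ends at a marker or in a periodic stretch. *)
Definition marker (p : conf) : bool :=
  all (fun d : nat => (rank (shift d.+1%:Z p) < rank p)%N &&
                      (rank (shift (- d.+1%:Z) p) < rank p)%N) (iota 0 D).

(** The distance to periodic stretches leaves room for the contexts between a marker cut and a
    periodic one. *)
Definition good_marker (p : conf) : bool :=
  marker p && all (fun d : nat => ~~ periodic_at (shift d%:Z p) &&
     ~~ periodic_at (shift (- d%:Z) p)) (iota 0 M2.+1).

Definition lengths : seq (nat * nat) :=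
  [seq (a, b) | a <- iota 0 L.+1, b <- iota 0 L.+1].

(** The words on the two sides of the origin and their concatenation share one relation, which is
    therefore idempotent. *)
Definition idem_split (l : nat * nat) (p : conf) : bool :=
  [&& (0 < l.1)%N, rl (pword p (- l.1%:Z) l.1) == rl (pword p 0 l.2) &
      rl (pword p (- l.1%:Z) (l.1 + l.2)) == rl (pword p 0 l.2)].

Definition splittable (p : conf) : bool := has (idem_split^~ p) lengths.

Definition split_lengths (p : conf) : nat * nat :=
  nth (0%N, 0%N) lengths (find (idem_split^~ p) lengths).

(** Taking the first admissible offset makes the cut a function of the marker. *)
Definition split_offset (p : conf) : nat :=
  find (fun b : nat => splittable (shift b%:Z p)) (iota 0 L.+1).

Definition marker_cut (p : conf) : bool :=
  has (fun b : nat => good_marker (shift (- b%:Z) p) &&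
                      (split_offset (shift (- b%:Z) p) == b)) (iota 0 L.+1).

Definition cut (p : conf) : bool := periodic_at p || marker_cut p.

Definition context (p : conf) : seq A :=
  if periodic_at p then pword p 0 QM
  else pword p (- (split_lengths p).1%:Z) ((split_lengths p).1 + (split_lengths p).2).

(* Outside the image of the automaton the context need not be good; the vertex of
   [p] itself then serves. *)
Definition cut_state (p : conf) : S :=
  if good_word E lam (context p) then G (context p) else p 0.

Definition radius (p : conf) : nat := if periodic_at p then QM else L.

Lemma periodicP (c : int) p : reflect
  (forall i : int, c - H%:Z <= i -> i + Q%:Z < c + H%:Z -> p i = p (i + Q%:Z))
  (periodic_at (shift c p)).
Proof.
apply: (iffP allP) => [h i i1 i2|h j].
  have /h/eqP : absz (i - c + H%:Z) \in iota 0 (H.*2 - Q).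
    by rewrite mem_iota; lia.
  rewrite /shift; have -> : (absz (i - c + H%:Z)%R)%:Z = i - c + H%:Z by lia.
  rewrite addrK => e.
  rewrite (_ : i = i - c + c) ?e; last by lia.
  by congr p; lia.
rewrite mem_iota => /andP[_ jn]; apply/eqP; rewrite /shift h; last 2 first.
- by lia.
- by lia.
by congr p; lia.
Qed.

Hypothesis D_dvd : forall d : nat, (0 < d <= D)%N -> (d %| Q)%N.
Hypothesis Q_gt0 : (0 < Q)%N.
Hypothesis QME : QM = (m * Q)%N.
Hypothesis m_gt0 : (0 < m)%N.
Hypothesis m_idem : forall r : {set S * S},
  relcomp (relpow r m) (relpow r m) = relpow r m.
Hypothesis L_ramsey : forall chi : nat -> nat -> {set S * S}, exists a b c,
  [/\ (a < b)%N, (b < c)%N, (c <= L)%N, chi a b = chi b c & chi a b = chi a c].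
(** Room for both radii and the mixing time between non-adjacent cuts. Between marker cuts one [L]
    is lost to the offset and two to the radii; between a marker cut and a periodic one, [L] to the
    offset and [L + QM] to the radii. Periodic cuts whose windows overlap in fewer than [Q]
    positions are more than [2 * H - Q] apart. *)
Hypothesis D_big : (3 * L + N0 < D)%N.
Hypothesis M2_big : (2 * L + QM + N0 <= M2)%N.
Hypothesis H_big : (2 * QM + Q + N0 <= H)%N.

(** The end windows overlap in at least [Q] positions, so every pair at distance [Q] in an
    intermediate window lies in one of them. *)
Lemma periodic_between p (c e : nat) :
  periodic_at p -> periodic_at (shift e%:Z p) -> (e <= H.*2 - Q)%N ->
  (c <= e)%N -> periodic_at (shift c%:Z p).
Proof.
rewrite -{1}[p]shift0 => /periodicP p0 /periodicP pe eH ce.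
apply/periodicP => i i1 i2.
by have [i3|i3] := ltP (i + Q%:Z) H%:Z; [apply: p0|apply: pe]; lia.
Qed.

(** Equal ranks mean equal blocks, which makes the absolute value of [d] a period inside the window,
    and [Q] is a multiple of it. *)
Lemma rank_eq_periodic p (d : int) : d != 0 -> (`|d| <= D)%N ->
  rank (shift d p) = rank p -> periodic_at p.
Proof.
move=> d0 dD /ord_inj/enum_rank_inj/ffunP e.
have {}e (i : int) : - H%:Z <= i -> i < H%:Z -> p i = p (i + d).
  move=> i1 i2; have iH : (absz (i + H%:Z)%R < H.*2)%N by lia.
  have := e (Ordinal iH); rewrite !ffunE /= /shift.
  have -> : (absz (i + H%:Z)%R)%:Z = i + H%:Z by lia.
  by rewrite addrK => ->.
have /dvdnP[q Qq] : (`|d| %| Q)%N by apply: D_dvd; lia.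
rewrite -[p]shift0; apply/periodicP => i i1 i2; rewrite !Qq.
have [dge|dlt] := leP 0 d.
  apply: (@period_chain _ p (- H%:Z) H%:Z) => [j j1 j2||]; [|lia|lia].
  by rewrite e; [congr p; lia|lia|lia].
apply: (@period_chain _ p (- H%:Z) H%:Z) => [j j1 j2||]; [|lia|lia].
by rewrite [RHS]e; [congr p; lia|lia|lia].
Qed.

Lemma marker_or_periodic p : exists2 j : int,
  (`|j| <= D * #|{ffun 'I_(H.*2) -> S}|)%N &
  marker (shift j p) || periodic_at (shift j p).
Proof.
have rkB q : (rank q < #|{ffun 'I_(H.*2) -> S}|)%N by exact: ltn_ord.
set B := #|_| in rkB *.
(* The bound that carries the induction: each move of at most [D] raises the rank by at least
   one. *)
suff [j jB mj] : exists2 j : int, (`|j| <= D * (B - rank p))%N &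
    marker (shift j p) || periodic_at (shift j p).
  by exists j => //; apply: leq_trans jB _; rewrite leq_mul2l leq_subr orbT.
have [n] := ubnP (B - rank p); elim: n p => // n IHn p pn.
have [mp|/allPn[d]] := boolP (marker p).
  by exists 0; rewrite ?absz0 ?shift0 ?mp.
rewrite mem_iota add0n => /andP[_ dD] nlt.
have [e [e0 eD le]] : exists e : int,
    [/\ e != 0, (`|e| <= D)%N & (rank p <= rank (shift e p))%N].
  move: nlt; rewrite negb_and -!leqNgt => /orP[] h.
    by exists d.+1%:Z; split => //; lia.
  by exists (- d.+1%:Z); split => //; lia.
have [re|rne] := eqVneq (rank (shift e p)) (rank p).
  by exists 0; rewrite ?absz0 // shift0 (rank_eq_periodic e0 eD) ?orbT.
have [|j jD mj] := IHn (shift e p); first by have := rkB (shift e p); lia.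
exists (j + e); last by rewrite -shiftD.
have lt : (rank p < rank (shift e p))%N by lia.
have -> : (B - rank p = (rank (shift e p) - rank p) + (B - rank (shift e p)))%N.
  by have := rkB (shift e p); lia.
have : (D * 1 <= D * (rank (shift e p) - rank p))%N by rewrite leq_mul2l; lia.
by rewrite mulnDr; lia.
Qed.

(** Ramsey's theorem for the relations of the words between two positions: the middle vertex of a
    monochromatic triangle is a place to split. *)
Lemma split_offsetP p : (split_offset p <= L)%N /\
  splittable (shift (split_offset p)%:Z p).
Proof.
have hs : has (fun b : nat => splittable (shift b%:Z p)) (iota 0 L.+1).
  have [a [b [c [ab bc cL e1 e2]]]] :=
    L_ramsey (fun i j => rl (pword p i%:Z (j - i))).
  apply/hasP; exists b; first by rewrite mem_iota; lia.
  apply/hasP; exists ((b - a)%N, (c - b)%N).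
    apply/allpairsP; exists ((b - a)%N, (c - b)%N); split; rewrite ?mem_iota //=; lia.
  rewrite /idem_split !pword_shift /=.
  have -> : - (b - a)%N%:Z + b%:Z = a%:Z by lia.
  have -> : (b - a + (c - b))%N = (c - a)%N by lia.
  by rewrite add0r -e1 -e2 !eqxx; lia.
have := hs; rewrite has_find size_iota ltnS => bL; split=> //.
by have := nth_find 0%N hs; rewrite nth_iota.
Qed.

Lemma marker_cutP p : reflect (exists b : nat, [/\ (b <= L)%N,
   good_marker (shift (- b%:Z) p) & split_offset (shift (- b%:Z) p) = b])
  (marker_cut p).
Proof.
apply: (iffP hasP) => [[b]|[b [bL gm /eqP ob]]].
  by rewrite mem_iota ltnS => /andP[_ bL] /andP[gm /eqP ob]; exists b.
by exists b; [rewrite mem_iota; lia|rewrite gm].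
Qed.

(** A nearby marker is either good, and followed by a cut within [L], or within [M2] of a periodic
    position, which is a cut. *)
Lemma cut_dense p : exists2 j : int,
  (`|j| <= D * #|{ffun 'I_(H.*2) -> S}| + M2 + L)%N & cut (shift j p).
Proof.
have [j jB /orP[mj|zj]] := marker_or_periodic p; last first.
  by exists j; [lia|rewrite /cut zj].
have [gj|] := boolP (good_marker (shift j p)).
  have [oL so] := split_offsetP (shift j p).
  exists ((split_offset (shift j p))%:Z + j); first by lia.
  apply/orP; right; apply/marker_cutP; exists (split_offset (shift j p)).
  by rewrite shiftD addrA addNr add0r; split.
rewrite /good_marker mj andTb => /allPn[d]; rewrite mem_iota !shiftD => /andP[_ dM].
rewrite negb_and !negbK => /orP[] zd.
  by exists (d%:Z + j); [lia|rewrite /cut zd].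
by exists (- d%:Z + j); [lia|rewrite /cut zd].
Qed.

(** Of two distinct markers within distance [D], each would have a strictly larger rank than the
    other. *)
Lemma marker_far p (i j : int) : marker (shift i p) -> marker (shift j p) ->
  i != j -> (D < `|i - j|)%N.
Proof.
move=> /allP mi /allP mj ij; rewrite ltnNge; apply/negP => ijD.
have k1 : (absz (i - j)%R).-1 \in iota 0 D by rewrite mem_iota; lia.
have := mi _ k1; have := mj _ k1; rewrite !shiftD.
have [h|h] := ltP i j.
  rewrite (_ : (absz (i - j)%R).-1.+1%:Z + i = j); last by lia.
  rewrite (_ : - (absz (i - j)%R).-1.+1%:Z + j = i); last by lia.
  lia.
rewrite (_ : (absz (i - j)%R).-1.+1%:Z + j = i); last by lia.
rewrite (_ : - (absz (i - j)%R).-1.+1%:Z + i = j); last by lia.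
lia.
Qed.

Lemma good_marker_far p (i j : int) : good_marker (shift i p) ->
  periodic_at (shift j p) -> (M2 < `|i - j|)%N.
Proof.
move=> /andP[_ /allP gi] zj; rewrite ltnNge; apply/negP => ijM.
have k1 : (absz (i - j)%R) \in iota 0 M2.+1 by rewrite mem_iota; lia.
have := gi _ k1; rewrite !shiftD => /andP[].
have [h|h] := ltP i j.
  by rewrite (_ : (absz (i - j)%R)%:Z + i = j) ?zj //; lia.
by rewrite (_ : - (absz (i - j)%R)%:Z + i = j) ?zj //; lia.
Qed.

(** The dichotomy behind the filling of segments: an adjacent pair of cuts will be joined by a
    single edge, any other pair leaves room for both contexts and for mixing. *)
Lemma cut_gap p (e : nat) : cut p -> cut (shift e%:Z p) -> (0 < e)%N ->
  (forall d : nat, (0 < d < e)%N -> ~~ cut (shift d%:Z p)) ->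
  [/\ e = 1%N, periodic_at p & periodic_at (shift e%:Z p)] \/
  ((radius p + radius (shift e%:Z p) <= e)%N /\ (N0 <= e)%N).
Proof.
move=> cp ce e0 nocut; rewrite /radius.
have [z0|nz0] := boolP (periodic_at p);
  have [ze|nze] := boolP (periodic_at (shift e%:Z p)).
(* When the two windows overlap in [Q] positions, all positions in between are periodic, hence cuts,
   which forces [e = 1]. *)
- have [eH|eH] := leqP e (H.*2 - Q); last by right; lia.
  left; split => //; case: (ltngtP e 1%N) => // [|e1]; first by lia.
  have := nocut 1%N; rewrite /cut (periodic_between z0 ze eH) //= e1.
  by move=> /(_ isT).
- right; move: ce; rewrite /cut (negbTE nze) /= => /marker_cutP[b [bL]].
  rewrite shiftD => gm _; rewrite -[p]shift0 in z0.
  have := good_marker_far gm z0; lia.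
- right; move: cp; rewrite /cut (negbTE nz0) /= => /marker_cutP[b [bL gm _]].
  have := good_marker_far gm ze; lia.
- right; move: cp; rewrite /cut (negbTE nz0) /= => /marker_cutP[b [bL gm ob]].
  move: ce; rewrite /cut (negbTE nze) /= => /marker_cutP[b' [bL' ]].
  rewrite !shiftD => gm' ob'.
  (* A marker determines its offset, so distinct cuts come from distinct markers. *)
  have [bb|nbb] := eqVneq (- b%:Z : int) (- b'%:Z + e%:Z).
    by move: ob'; rewrite -bb ob; lia.
  have /andP[mm _] := gm; have /andP[mm' _] := gm'.
  have := marker_far mm mm' nbb; lia.
Qed.

Lemma splittableP p : splittable p ->
  [/\ idem_split (split_lengths p) p, ((split_lengths p).1 <= L)%N &
      ((split_lengths p).2 <= L)%N].
Proof.
move=> sp; have := sp; rewrite /splittable has_find => lt.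
have := mem_nth (0%N, 0%N) lt => /allpairsP[[a b] [aI bI e]].
split; first exact: (nth_find (0%N, 0%N) sp).
  by rewrite /split_lengths e; move: aI; rewrite -[(a, b).1]/a mem_iota; lia.
by rewrite /split_lengths e; move: bI; rewrite -[(a, b).2]/b mem_iota; lia.
Qed.

Lemma rl_pword_mul p (n : nat) :
  (forall i : int, 0 <= i -> i + Q%:Z < (n * Q)%N%:Z -> p i = p (i + Q%:Z)) ->
  rl (pword p 0 (n * Q)) = relpow (rl (pword p 0 Q)) n.
Proof.
elim: n => [|n IHn] pQ //; rewrite mulSn addnC pword_cat rlab_cat IHn; last first.
  by move=> i i1 i2; apply: pQ => //; lia.
rewrite add0r (_ : pword p _ Q = pword p 0 Q); last first.
  apply: eq_pword => j jQ; rewrite add0r [LHS](_ : _ = p (j%:Z + (n * Q)%N%:Z)).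
    by rewrite -(@period_chain _ p 0 (n.+1 * Q)%N%:Z) //; lia.
  by congr p; lia.
rewrite -[X in relcomp _ X]relcompr1 -[relcomp _ _]/(relcomp _ (relpow _ 1)).
by rewrite -relpowD addnC.
Qed.

(** This lets a context stand for either side of its cut. In a periodic stretch both sides read the
    same [QM] letters, and the exponent [m] gives idempotence; near a marker the two words come from
    the splitting. *)
Lemma contextP p : cut p -> exists l1 l2 : nat,
  [/\ (l1 <= radius p)%N, (l2 <= radius p)%N,
      rl (pword p (- l1%:Z) l1) = rl (context p) &
      rl (pword p 0 l2) = rl (context p)] /\
  [/\ (0 < size (context p))%N, idem_word E lam (context p) &
      (size (context p) <= 2 * L + QM)%N].
Proof.
rewrite /cut /radius /context; have [zp|nzp /= ] := boolP (periodic_at p).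
  move=> _; exists QM, QM; rewrite size_pword !leqnn; split; last first.
    split; [by rewrite QME muln_gt0 m_gt0| |lia].
    rewrite /idem_word QME rl_pword_mul ?m_idem //.
    rewrite -[p]shift0 in zp; move/periodicP: zp => zp i i1 i2.
    by apply: zp; lia.
  split=> //; congr (rl _); apply: eq_pword => j jQ.
  rewrite -[p]shift0 in zp; move/periodicP: zp => zp.
  rewrite QME (@period_chain _ p (- H%:Z) H%:Z Q m); [congr p; lia| |lia|lia].
  by move=> i i1 i2; apply: zp; lia.
move=> /marker_cutP[b [bL _ ob]].
have [_] := split_offsetP (shift (- b%:Z) p); rewrite ob shiftD addrN shift0.
move=> /splittableP[]; case: (split_lengths p) => l1 l2 /=.
move=> /and3P[/= l10 /eqP e1 /eqP e2 l1L l2L].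
exists l1, l2; rewrite size_pword; split; first by rewrite e2; split.
split; [lia| |lia].
rewrite /idem_word e2 -{3}e2 pword_cat rlab_cat.
by rewrite [- l1%:Z + _]addNr -e1.
Qed.

Lemma inhab_factor (r1 r2 r3 : {set S * S}) :
  inhab (relcomp r1 (relcomp r2 r3)) -> inhab r2.
Proof.
move=> /inhabP[s [t /relcompP[q _ /relcompP[q' h _]]]].
by apply/inhabP; exists q, q'.
Qed.

(** By idempotence the relation of [a :: w] is that of its square, which has [rcons w a] as a
    factor, and symmetrically. *)
Lemma inhab_rot a w : idem_word E lam (a :: w) -> idem_word E lam (rcons w a) ->
  inhab (rl (a :: w)) = inhab (rl (rcons w a)).
Proof.
rewrite /idem_word => /eqP i1 /eqP i2; apply/idP/idP.
  rewrite -i1 -rlab_cat cat_cons -cat_rcons -cat1s !rlab_cat; exact: inhab_factor.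
rewrite -i2 -rlab_cat cat_rcons -cats1 -cat_cons !rlab_cat.
exact: inhab_factor.
Qed.

Lemma cycle_path n s q : (0 < n)%N -> walk E n s s q ->
  exists2 p : conf, (forall i, E (p i) (p (i + 1))) & p 0 = s.
Proof.
move=> n0 [q0 qn Eq]; exists (fun i => q (absz (i %% n)%Z)); last by rewrite mod0z.
move=> i; set k := absz (i %% n)%Z.
have nz : n%:Z != 0 by lia.
have kE : k%:Z = (i %% n)%Z by rewrite /k; have := modz_ge0 i nz; lia.
have kn : (k < n)%N by have := ltz_pmod i (d := n); lia.
have iE : i + 1 = (i %/ n)%Z * n + k.+1%:Z by rewrite {1}(divz_eq i n) -kE; lia.
rewrite iE modzMDl; case: (ltngtP k.+1 n) => kn'.
- by rewrite modz_small ?absz_nat ?Eq //; lia.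
- by lia.
- by rewrite kn' modzz absz0 q0 -qn -kn'; exact: Eq.
Qed.

(** Twice the distance of [cut_dense], applied to a centre on the left or on the right of the
    origin, covers a cut on the wanted side. *)
Definition cut_bound : nat := ((D * #|{ffun 'I_(H.*2) -> S}| + M2 + L).*2.+2)%N.

(** The origin counts as a previous cut but not as a next one, so each position lies in exactly one
    half-open segment. *)
Definition prev_cut (p : conf) : nat :=
  find (fun d : nat => cut (shift (- d%:Z) p)) (iota 0 cut_bound).

Definition next_cut (p : conf) : nat :=
  (find (fun e : nat => cut (shift e.+1%:Z p)) (iota 0 cut_bound)).+1.

Lemma prev_cutP p : [/\ cut (shift (- (prev_cut p)%:Z) p), (prev_cut p < cut_bound)%N
  & forall d, (d < prev_cut p)%N -> ~~ cut (shift (- d%:Z) p)].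
Proof.
have hs : has (fun d : nat => cut (shift (- d%:Z) p)) (iota 0 cut_bound).
  set B := (D * #|{ffun 'I_(H.*2) -> S}| + M2 + L)%N.
  have [j jB cj] := cut_dense (shift (- B%:Z) p).
  apply/hasP; exists (absz (j - B%:Z)%R).
    by rewrite mem_iota /cut_bound -/B; lia.
  by move: cj; rewrite shiftD; congr (cut (shift _ p)); lia.
have := hs; rewrite has_find size_iota => lt; split=> //.
  by have := nth_find 0%N hs; rewrite nth_iota.
move=> d dp; have := before_find 0%N dp; rewrite nth_iota ?add0n; last first.
  exact: ltn_trans dp lt.
by move=> ->.
Qed.

Lemma next_cutP p : [/\ cut (shift (next_cut p)%:Z p), (next_cut p <= cut_bound)%N
  & forall e, (0 < e < next_cut p)%N -> ~~ cut (shift e%:Z p)].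
Proof.
have hs : has (fun d : nat => cut (shift d.+1%:Z p)) (iota 0 cut_bound).
  set B := (D * #|{ffun 'I_(H.*2) -> S}| + M2 + L)%N.
  have [j jB cj] := cut_dense (shift B.+1%:Z p).
  apply/hasP; exists (absz (j + B%:Z)%R).
    by rewrite mem_iota /cut_bound -/B; lia.
  by move: cj; rewrite shiftD; congr (cut (shift _ p)); lia.
have := hs; rewrite has_find size_iota => lt; split=> //.
  by have := nth_find 0%N hs; rewrite nth_iota.
case=> // e; rewrite /= ltnS => ep; have := @before_find _ 0%N _ _ e ep.
rewrite nth_iota ?add0n; last exact: ltn_trans ep lt.
by move=> ->.
Qed.

Lemma prev_cut_uniq p d : cut (shift (- d%:Z) p) ->
  (forall d', (d' < d)%N -> ~~ cut (shift (- d'%:Z) p)) -> prev_cut p = d.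
Proof.
move=> cd nd; have [cp _ np] := prev_cutP p.
by case: (ltngtP (prev_cut p) d) => // [/nd|/np]; rewrite ?cp ?cd.
Qed.

Lemma next_cut_uniq p e : (0 < e)%N -> cut (shift e%:Z p) ->
  (forall d, (0 < d < e)%N -> ~~ cut (shift d%:Z p)) -> next_cut p = e.
Proof.
move=> e0 cd nd; have [cp _ np] := next_cutP p.
case: (ltngtP (next_cut p) e) => // h.
  by have := nd (next_cut p) h; rewrite cp.
by have := np e; rewrite cd e0 h => /(_ isT).
Qed.

(** * Filling in the segments between cuts *)

Variable P : nat.
Hypothesis P_big : (2 * L + QM + 2 * cut_bound <= P)%N.
Hypothesis G_table : section_table E lam P G.
Hypothesis mix : forall p p' : conf, (forall i, E (p i) (p (i + 1))) ->
  (forall i, E (p' i) (p' (i + 1))) ->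
  forall n, (N0 <= n)%N -> exists q, walk E n (p 0) (p' 0) q.

Lemma table_loop u : good_word E lam u -> (size u <= P)%N -> (G u, G u) \in rl u.
Proof.
move=> gu uP; have /and3P[_ /eqP iu hu] := gu; have [h _] := G_table.
have := h u [::] u gu gu uP _ uP; rewrite !rlab_cat /= relcomp1r iu.
exact.
Qed.

(** Mixing concerns vertices of bi-infinite paths only; a vertex of the table lies on one, obtained
    by repeating its loop. *)
Lemma cut_state_path p : cut p -> (forall i, E (p i) (p (i + 1))) ->
  exists2 p' : conf, (forall i, E (p' i) (p' (i + 1))) & p' 0 = cut_state p.
Proof.
move=> cp Ep; rewrite /cut_state; case: ifP => gu; last by exists p.
have [_ [_ [_ [u0 _ uL]]]] := contextP cp.
have [|q [q1 _]] := (rlabP E lam _ _ _).1 (table_loop gu _).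
  by lia.
exact: cycle_path q1.
Qed.

Lemma good_context p p' : cut p -> (forall i, E (p' i) (p' (i + 1))) ->
  (forall i, lam (p' i) = pi (p i)) -> good_word E lam (context p).
Proof.
move=> cp Ep' lp'; have [l1 [l2 [[_ _ _ e2] [u0 iu _]]]] := contextP cp.
rewrite /good_word u0 iu -e2; apply/inhabP.
by exists (p' 0), (p' (0 + l2%:Z)); apply: rl_path.
Qed.

(** The unlabelled walk serves configurations outside the image, where the lift still has to be a
    path; the labelled one makes the lift a preimage. *)
Lemma segment p (e : nat) : (forall i, E (p i) (p (i + 1))) ->
  cut p -> cut (shift e%:Z p) -> (0 < e <= 2 * cut_bound)%N ->
  (forall d : nat, (0 < d < e)%N -> ~~ cut (shift d%:Z p)) ->
  (exists q, walk E e (cut_state p) (cut_state (shift e%:Z p)) q) /\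
  (forall p', (forall i, E (p' i) (p' (i + 1))) ->
     (forall i, lam (p' i) = pi (p i)) ->
     (cut_state p, cut_state (shift e%:Z p)) \in rl (pword p 0 e)).
Proof.
move=> Ep cp ce /andP[e0 eK] nocut.
have Ese : forall i, E (shift e%:Z p i) (shift e%:Z p (i + 1)).
  by move=> i; rewrite /shift addrAC.
have [l1 [l2 [[l1r l2r e1 e2] [u0 iu uL]]]] := contextP cp.
have [l1' [l2' [[l1r' l2r' e1' e2'] [u0' iu' uL']]]] := contextP ce.
have [[eq1 zp ze]|[rad N0e]] := cut_gap cp ce e0 nocut; last first.
  split=> [|p' Ep' lp'].
    have [p1 Ep1 <-] := cut_state_path cp Ep.
    have [p2 Ep2 <-] := cut_state_path ce Ese.
    exact: mix.
  have g1 := good_context cp Ep' lp'.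
  have g2 : good_word E lam (context (shift e%:Z p)).
    apply: (good_context ce (p' := shift e%:Z p')) => i; rewrite /shift ?lp' //.
    by rewrite addrAC.
  (* The words next to the two cuts have the relations of their contexts, so the contexts can
     replace them and the first clause of the table applies. *)
  have wE : rl (pword p 0 e) = rl (context p ++ pword p l2%:Z (e - l1' - l2) ++
                                  context (shift e%:Z p)).
    have -> : pword p 0 e = pword p 0 (l2 + ((e - l1' - l2) + l1')).
      by congr (pword _ _ _); lia.
    rewrite !pword_cat !rlab_cat e2 -e1' pword_shift add0r.
    by rewrite (_ : l2%:Z + (e - l1' - l2)%N%:Z = - l1'%:Z + e%:Z) //; lia.
  have [h _] := G_table; rewrite /cut_state g1 g2 wE; apply: h => //.
  - lia.
  - rewrite size_pword; lia.
  - lia.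
  - rewrite -wE; apply/inhabP; exists (p' 0), (p' (0 + e%:Z)); exact: rl_path.
(* Adjacent cuts: as [Q] divides [QM], the two contexts are rotations of each other by one letter.
   They are good together, and the second clause of the table applies. *)
rewrite {}eq1 in ce iu' uL' ze Ese *.
have qm0 : (0 < QM)%N by rewrite QME muln_gt0 m_gt0.
have uE : context p = pi (p 0) :: pword p 1 QM.-1.
  rewrite /context zp -{1}(prednK qm0) -add1n pword_cat add0r.
  by rewrite /pword /= add0r.
have uE' : context (shift 1 p) = rcons (pword p 1 QM.-1) (pi (p 0)).
  rewrite /context ze pword_shift add0r -{1}(prednK qm0) -addn1 pword_cat -cats1.
  congr (_ ++ _); rewrite /pword /= addr0; congr [:: pi _].
  rewrite -[p]shift0 in zp; move/periodicP: zp => zp.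
  rewrite [RHS](@period_chain _ p (- H%:Z) H%:Z Q m); last 2 first.
  - by lia.
  - by rewrite -QME; lia.
  - by congr p; rewrite -QME; lia.
  - by move=> i i1 i2; apply: zp; lia.
have gg : good_word E lam (context (shift 1 p)) = good_word E lam (context p).
  rewrite uE in iu; rewrite uE' in iu'.
  by rewrite /good_word uE uE' iu iu' inhab_rot // size_rcons.
have Gstep : good_word E lam (context p) ->
    (cut_state p, cut_state (shift 1 p)) \in step E lam (pi (p 0)).
  move=> gu; rewrite /cut_state gg gu uE uE'; have [_ h] := G_table.
  by apply: h; rewrite -?uE -?uE' ?gg //; rewrite size_pword; lia.
split=> [|p' Ep' lp']; last first.
  rewrite /pword /= addr0 relcompr1; apply: Gstep; exact: good_context Ep' lp'.
exists (fun i => if i is 0%N then cut_state p else cut_state (shift 1 p)).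
split=> // -[] // _; have [/Gstep|] := boolP (good_word E lam (context p)).
  by rewrite inE => /andP[].
(* Without good contexts both states are vertices of [p] itself, joined by an edge of [p]. *)
by rewrite /cut_state gg => /negbTE ->; rewrite /shift -{1}[0]/(0 : int); exact: Ep.
Qed.

(** The walk is chosen from the word and the end vertices alone, which keeps the lift local. A
    labelled walk is preferred, then any walk. *)
Lemma route_exists : exists route : seq A -> S -> S -> nat -> S, forall w s t,
  ((exists q, walk E (size w) s t q) -> walk E (size w) s t (route w s t)) /\
  ((s, t) \in rl w -> lwalk E lam w s t (route w s t)).
Proof.
have /choice[f fP] : forall x : seq A * S * S, exists q : nat -> S,
   ((exists q, walk E (size x.1.1) x.1.2 x.2 q) ->
     walk E (size x.1.1) x.1.2 x.2 q) /\
   ((x.1.2, x.2) \in rl x.1.1 -> lwalk E lam x.1.1 x.1.2 x.2 q).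
  move=> [[w s] t] /=.
  have [/rlabP[q lq]|nst] := boolP ((s, t) \in rl w).
    by exists q; split => // _; case: lq.
  have [[q wq]|nq] := pselect (exists q, walk E (size w) s t q).
    by exists q.
  by exists (fun=> s).
by exists (fun w s t => f (w, s, t)) => w s t; exact: (fP (w, s, t)).
Qed.

Lemma locl_periodic : locl periodic_at.
Proof. by apply: locl_all => j; apply: locl_comp2; exact: locl_eval. Qed.

Lemma locl_rank : locl rank.
Proof.
exists H => p p' pp'; rewrite /rank; congr (nat_of_ord (enum_rank _)).
by apply/ffunP => j; rewrite !ffunE; apply: pp'; have := ltn_ord j; lia.
Qed.

Lemma locl_split l : locl (idem_split l).
Proof.
apply: (locl_comp2 andb); first exact: locl_const.
apply: (locl_comp2 andb); apply: locl_comp2; apply: locl_comp; exact: locl_pword.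
Qed.

Lemma locl_good_marker : locl good_marker.
Proof.
apply: (locl_comp2 andb); apply: locl_all => d.
  by apply: (locl_comp2 andb); apply: (locl_comp2 (fun a b => a < b)%N);
    [apply: locl_shift|..]; try exact: locl_rank; apply: locl_shift; exact: locl_rank.
by apply: (locl_comp2 andb); apply: (locl_comp negb); apply: locl_shift;
  exact: locl_periodic.
Qed.

Lemma locl_split_offset : locl split_offset.
Proof.
apply: locl_find => b; apply: (locl_shift (f := splittable)).
apply: locl_has => l; exact: locl_split.
Qed.

Lemma locl_cut : locl cut.
Proof.
apply: (locl_comp2 orb); first exact: locl_periodic.
apply: locl_has => b; apply: (locl_comp2 andb).
  exact/locl_shift/locl_good_marker.
by apply: (locl_comp (eq_op^~ b)); exact/locl_shift/locl_split_offset.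
Qed.

Lemma locl_context : locl context.
Proof.
apply: locl_if; [exact: locl_periodic|exact: locl_pword|].
apply: (locl_dep (N := (size lengths).+1)
  (d := fun p => find (idem_split^~ p) lengths)
  (F := fun i p => let l := nth (0, 0)%N lengths i in
                   pword p (- l.1%:Z) (l.1 + l.2))) => [|p|i].
- by apply: locl_find => l; exact: locl_split.
- by rewrite ltnS find_size.
- exact: locl_pword.
Qed.

Lemma locl_cut_state : locl cut_state.
Proof.
apply: locl_if; last exact: locl_eval.
  by apply: locl_comp; exact: locl_context.
by apply: locl_comp; exact: locl_context.
Qed.

(** The lift follows, between consecutive cuts, the route chosen for that segment. It is local
    because the distances to the cuts are bounded local functions. *)
Theorem local_lift : exists2 h : conf -> S, locl h &
  forall p, (forall i, E (p i) (p (i + 1))) ->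
  E (h p) (h (shift 1 p)) /\
  forall p', (forall i, E (p' i) (p' (i + 1))) ->
     (forall i, lam (p' i) = pi (p i)) -> lam (h p) = pi (p 0).
Proof.
have [route routeP] := route_exists.
pose h (p : conf) := route (pword p (- (prev_cut p)%:Z) (prev_cut p + next_cut p))
  (cut_state (shift (- (prev_cut p)%:Z) p)) (cut_state (shift (next_cut p)%:Z p))
  (prev_cut p).
exists h.
  apply: (@locl_dep _ _ cut_bound prev_cut (fun d p => route
    (pword p (- d%:Z) (d + next_cut p))
    (cut_state (shift (- d%:Z) p)) (cut_state (shift (next_cut p)%:Z p)) d)).
  - by apply: locl_find => d; exact/locl_shift/locl_cut.
  - by move=> p; case: (prev_cutP p).
  move=> d; apply: (@locl_dep _ _ cut_bound.+1 next_cut (fun e p => route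
    (pword p (- d%:Z) (d + e))
    (cut_state (shift (- d%:Z) p)) (cut_state (shift e%:Z p)) d)).
  - by apply: (locl_comp succn); apply: locl_find => e; exact/locl_shift/locl_cut.
  - by move=> p; case: (next_cutP p).
  move=> e; apply: (@locl_comp2 _ _ _ _ (fun w f => f w d)
    (fun p => pword p (- d%:Z) (d + e)) (fun p w => route w
    (cut_state (shift (- d%:Z) p)) (cut_state (shift e%:Z p)))).
    exact: locl_pword.
  by apply: (locl_comp2 (fun s t w => route w s t)); apply: locl_shift;
    exact: locl_cut_state.
have hwalk p : (forall i, E (p i) (p (i + 1))) ->
    let w := pword p (- (prev_cut p)%:Z) (prev_cut p + next_cut p) in
    let s := cut_state (shift (- (prev_cut p)%:Z) p) in
    let t := cut_state (shift (next_cut p)%:Z p) in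
    walk E (prev_cut p + next_cut p) s t (route w s t) /\
    forall p', (forall i, E (p' i) (p' (i + 1))) ->
      (forall i, lam (p' i) = pi (p i)) -> lwalk E lam w s t (route w s t).
  move=> Ep w s t.
  have [cd dK nd] := prev_cutP p; have [ce eK ne] := next_cutP p.
  have e0 : (0 < next_cut p)%N by [].
  set d := prev_cut p in cd dK nd w s t *; set e := next_cut p in ce eK ne e0 w s t *.
  have [|||||free lab] := @segment (shift (- d%:Z) p) (d + e).
  - by move=> i; rewrite /shift addrAC.
  - exact: cd.
  - by rewrite shiftD (_ : (d + e)%N%:Z + - d%:Z = e%:Z) //; lia.
  - by lia.
  - move=> c /andP[c0 cde]; rewrite shiftD; have [cd'|dc] := ltnP c d.
      by rewrite (_ : c%:Z - d%:Z = - (d - c)%N%:Z); [apply: nd; lia|lia].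
    case: (ltngtP c d) dc => // [dc|dc] _.
      by rewrite (_ : c%:Z - d%:Z = (c - d)%N%:Z); [apply: ne; lia|lia].
    by rewrite (_ : c%:Z - d%:Z = - 0%N%:Z); [apply: nd; lia|lia].
  rewrite shiftD (_ : (d + e)%N%:Z + - d%:Z = e%:Z) in free lab; last by lia.
  have [rfree rlab] := routeP w s t; rewrite size_pword in rfree.
  split; first exact: rfree.
  move=> p' Ep' lp'; apply: rlab.
  rewrite /w -[- d%:Z]add0r -pword_shift.
  apply: (lab (shift (- d%:Z) p')) => i; last by rewrite /shift lp'.
  by rewrite /shift addrAC.
move=> p Ep; have [[q0 qn Eq] lq] := hwalk p Ep.
have pn : (prev_cut p < prev_cut p + next_cut p)%N by rewrite -addn1 leq_add2l.
split; last first.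
  move=> p' Ep' lp'; have [_ {}lq] := lq p' Ep' lp'.
  by rewrite /h (lq _ (pi (p 0))) ?nth_pword ?addNr ?size_pword.
have Ep1 : forall i, E (shift 1 p i) (shift 1 p (i + 1)).
  by move=> i; rewrite /shift addrAC.
have [[q0' _ _] _] := hwalk _ Ep1.
have [cd dK nd] := prev_cutP p; have [ce eK ne] := next_cutP p.
move: pn => /Eq.
(* The lift at the next position has to be the next vertex of the route. If that position is a cut,
   it opens a segment starting with the last vertex of the old one; otherwise the segment is the
   same, with offsets moved by one. *)
congr (E _ _); have [e1|e1] := eqVneq (next_cut p) 1%N.
  have dn0 : prev_cut (shift 1 p) = 0%N.
    by apply: prev_cut_uniq; rewrite // shift0 -[1]/(1%N%:Z) -e1.
  rewrite dn0 in q0'; rewrite /h dn0 q0' oppr0 shift0.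
  by rewrite -[1]/(1%N%:Z) -{1}e1 -[RHS]qn; congr (route _ _ _ _); rewrite e1 addn1.
have n1 : (0 < 1 < next_cut p)%N.
  by have : (0 < next_cut p)%N by []; lia.
have dn1 : prev_cut (shift 1 p) = (prev_cut p).+1.
  apply: prev_cut_uniq => [|[|d] dp]; rewrite shiftD.
  - by rewrite (_ : - (prev_cut p).+1%:Z + 1 = - (prev_cut p)%:Z) //; lia.
  - rewrite (_ : - 0%N%:Z + 1 = 1%N%:Z); last by lia.
    exact: (ne 1%N n1).
  - by rewrite (_ : - d.+1%:Z + 1 = - d%:Z); [apply: nd; lia|lia].
have en1 : next_cut (shift 1 p) = (next_cut p).-1.
  apply: next_cut_uniq => [||d dp]; rewrite ?shiftD.
  - by lia.
  - by rewrite (_ : (next_cut p).-1%:Z + 1 = (next_cut p)%:Z) //; lia.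
  - by rewrite (_ : d%:Z + 1 = d.+1%:Z); [apply: ne; lia|lia].
rewrite /h dn1 en1 pword_shift !shiftD.
rewrite (_ : - (prev_cut p).+1%:Z + 1 = - (prev_cut p)%:Z); last by lia.
rewrite (_ : (next_cut p).-1%:Z + 1 = (next_cut p)%:Z); last by lia.
rewrite (_ : (prev_cut p).+1 + (next_cut p).-1 = prev_cut p + next_cut p)%N //.
by lia.
Qed.

End Cuts.

Theorem graph_lift (S A : finType) (E : rel S) (lam pi : S -> A) :
  (exists N0, forall p p' : int -> S, (forall i, E (p i) (p (i + 1))) ->
    (forall i, E (p' i) (p' (i + 1))) ->
    forall n, (N0 <= n)%N -> exists q, walk E n (p 0) (p' 0) q)%R ->
  (forall P, exists G, section_table E lam P G) ->
  exists2 h : (int -> S) -> S, locl h &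
    forall p, (forall i, E (p i) (p (i + 1)))%R ->
    E (h p) (h (shift 1 p)) /\
    forall p', (forall i, E (p' i) (p' (i + 1)))%R ->
      (forall i, lam (p' i) = pi (p i)) -> lam (h p) = pi (p 0%R).
Proof.
move=> [N0 mix] tables.
have [L ramsey] := ramsey_triangle {set S * S}.
have [m m0 idem] := relpow_idem_exponent S.
(* The factorial of [D] is the common period [Q]. *)
pose D := (3 * L + N0).+1; pose QM := (m * D`!)%N.
pose M2 := (2 * L + QM + N0)%N; pose H := (2 * QM + D`! + N0)%N.
(* The bound can be fixed before the table, since the positions of the cuts do not depend on [G]. *)
pose P := (2 * L + QM + 2 * cut_bound S L D M2 H)%N.
have [G tableG] := tables P.
apply: (@local_lift S A E lam pi G L D D`! m QM N0 M2 H _ _ _ _ _ _ _ _ _ P) => //.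
- by move=> d; exact: dvdn_fact.
- exact: fact_gt0.
Qed.

(** * Cellular automata as local rules *)

Section Compactness.
Variable k : nat.
Local Open Scope classical_set_scope.
Local Open Scope ring_scope.

Lemma near_agree (x : config k) (n : nat) : \forall y \near x, agree n x y.
Proof.
have Fx : Filter (nbhs x) := nbhs_filter x.
have near_coord (i : int) : \forall y \near x, x i = y i.
  have ci := @proj_continuous int
    (fun=> discrete_topology 'I_k : topologicalType) i x.
  have := ci _ (discrete_set1 _) => /= xn.
  by apply: (@filterS _ (nbhs x) _ _ _ _ xn) => y /= xy; exact: esym xy.
elim: n => [|n IHn].
  by apply: filterS (near_coord 0) => y xy i; rewrite leqn0 absz_eq0 => /eqP ->.
apply: filterS3 IHn (near_coord n.+1%:Z) (near_coord (- n.+1%:Z)) => y xy e1 e2 i.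
rewrite leq_eqVlt ltnS => /orP[/eqP iE|]; last exact: xy.
by have [->|->] : i = n.+1%:Z \/ i = - n.+1%:Z by lia.
Qed.

(** Otherwise there are configurations outside [U] that agree with [x] on ever larger windows, and
    they converge to [x]. *)
Lemma nbhs_agree (x : config k) (U : set (config k)) :
  nbhs x U -> exists n, forall y, agree n x y -> U y.
Proof.
move=> xU; apply: contrapT => /forallNP nU.
have /choice[y yP] : forall n, exists y, agree n x y /\ ~ U y.
  move=> n; apply: contrapT => /forallNP h; apply: (nU n) => y xy.
  by apply: contrapT => Uy; apply: (h y).
have cy : y @ \oo --> x.
  apply/cvg_sup => i V [_ [[B oB <-] Bx BV]].
  exists `|i|%N => // j /= ij; apply: BV => /=.
  rewrite /proj -(_ : x i = y j i); first exact: Bx.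
  by have [xy _] := yP j; apply: xy.
have [n _ nn] := cy U xU.
by have [_] := yP n; apply; apply: nn => /=.
Qed.

Lemma config_cluster (y : nat -> config k) : exists x : config k,
  forall n N, exists2 j, (N <= j)%N & agree n x (y j).
Proof.
have ct : compact [set: config k].
  have := @tychonoff int (fun=> discrete_topology 'I_k : topologicalType)
    (fun=> setT) _.
  rewrite (_ : [set f | _] = setT); last by apply/seteqP.
  by apply=> i; apply: finite_compact; exact: finite_finset.
have [x [_ cx]] := ct (y @ \oo) _ filterT.
exists x => n N; have [] := cx (y @` [set j | (N <= j)%N]) _ _ (near_agree x n).
  by exists N => // j /= Nj; exists j.
by move=> _ [[j Nj <-] xy]; exists j.
Qed.

End Compactness.

Section Endomorphisms.
Variables (k : nat) (X : subshift k).
Local Open Scope classical_set_scope.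
Local Open Scope ring_scope.

Definition ca (g : config k -> 'I_k) (x : config k) : config k :=
  fun i => g (shift i x).

Lemma ca_shiftC g i x : ca g (shift i x) = shift i (ca g x).
Proof. by apply/funext => j; rewrite /ca shiftD. Qed.

Lemma val_shift_on (x : X) i : val (iter i (@shift_on k X) x) = shift i%:Z (val x).
Proof.
elim: i => [|i IHi] /=; first by rewrite shift0.
by rewrite IHi -addn1 PoszD addrC -shiftD.
Qed.

Lemma subshift_shift (x : config k) (i : int) :
  subshift_set X x -> subshift_set X (shift i x).
Proof.
have pos x' (n : nat) : subshift_set X x' -> subshift_set X (shift n%:Z x').
  move=> Xx'; have := set_valP (iter n (@shift_on k X) (SigSub (mem_set Xx'))).
  by rewrite val_shift_on.
case: i => n Xx; first exact: pos.
(* The inverse shift preserves [X] because the shift maps [X] onto itself. *)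
have neg x' : subshift_set X x' -> subshift_set X (shift (- 1) x').
  have /seteqP[_ sX] := subshift_invariant X; move=> /sX[x1 Xx1 <-].
  by rewrite -[shift_map x1]/(shift 1 x1) shiftD addNr shift0.
elim: n => [|n IHn]; first exact: neg.
have -> : Negz n.+1 = -1 + Negz n by rewrite !NegzE; lia.
by rewrite -shiftD; exact: neg.
Qed.

Lemma near_agree_on (x : X) n : \forall y \near x, agree n (val x) (val y).
Proof.
have := @initial_continuous _ _ (set_val : X -> config k) x _
   (near_agree (val x) n).
exact.
Qed.

Lemma local_End (g : config k -> 'I_k) : locl g ->
  (forall x, subshift_set X x -> subshift_set X (ca g x)) -> exists b : End X,
  forall x : X, val (b x) = ca g (val x).
Proof.
move=> [n gn] gX.
pose b (x : X) : X := SigSub (mem_set (gX _ (set_valP x))).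
have bE x : val (b x) = ca g (val x) by [].
have cb : continuous b.
  apply: continuous_comp_initial => x.
  have Fx : Filter (nbhs x) := nbhs_filter x.
  apply/cvg_sup => i.
  have ci : continuous ((fun y : X => ca g (val y)) : X ->
      initial_topology (@proj int (fun=> discrete_topology 'I_k) i)).
    apply: continuous_comp_initial => y U /= /nbhs_singleton Uy.
    apply: filterS (near_agree_on y (n + `|i|)) => z yz /=.
    rewrite /preimage /= /proj /ca.
    rewrite -(gn (shift i (val y))) // => j jn; apply: yz; lia.
  exact: ci.
have sb (x : X) : b (shift_on x) = shift_on (b x).
  apply: val_inj; rewrite bE; exact: (ca_shiftC g 1 (val x)).
by exists (CellularAutomaton cb sb).
Qed.

(** The Curtis-Hedlund-Lyndon theorem. *)
Lemma End_local (b : End X) : (0 < k)%N -> exists2 g : config k -> 'I_k, locl g &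
  forall x : X, val (b x) = ca g (val x).
Proof.
move=> k0; pose a0 := Ordinal k0.
have bshift (x y : X) i : val y = shift i (val x) -> val (b y) = shift i (val (b x)).
  have pos (x' y' : X) (n : nat) : val y' = shift n%:Z (val x') ->
      val (b y') = shift n%:Z (val (b x')).
    rewrite -!val_shift_on => /val_inj ->; congr val.
    by elim: n => //= n <-; rewrite ca_shift.
  case: i => n; first exact: pos.
  move=> yx; rewrite (pos y x n.+1) ?shiftD ?NegzE ?addNr ?shift0 //.
  by rewrite yx NegzE shiftD addrN shift0.
(* A uniform radius: pairs that agree on ever larger windows but differ in their images at 0 would
   cluster at a point where continuity fails. *)
have [n bn] : exists n, forall x y : X, agree n (val x) (val y) ->
    val (b x) 0 = val (b y) 0.
  apply: contrapT => /forallNP nb.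
  have /choice[xy xyP] : forall n, exists xy : X * X,
      agree n (val xy.1) (val xy.2) /\ val (b xy.1) 0 <> val (b xy.2) 0.
    move=> n; apply: contrapT => /forallNP h; apply: (nb n) => x y xy.
    by apply: contrapT => bxy; apply: (h (x, y)).
  have [x xcl] := config_cluster (fun n => val (xy n).1).
  have Xx : subshift_set X x.
    apply: subshift_closed => U /nbhs_agree[n nU].
    have [j _ xj] := xcl n 0%N.
    by exists (val (xy j).1); split; [exact: set_valP|exact: nU].
  pose x' : X := SigSub (mem_set Xx).
  have [n nb'] : exists n, forall y : X, agree n x (val y) ->
      val (b y) 0 = val (b x') 0.
    have [_ [[B oB <-] Bx BV]] := ca_continuous (near_agree_on (b x') 0).
    have [n nB] := nbhs_agree (open_nbhs_nbhs (conj oB Bx)).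
    by exists n => y /nB/BV/= /(_ 0 isT) /esym.
  have [j nj xj] := xcl n n; have [xyj] := xyP j; apply.
  rewrite (nb' _ xj) nb' // => i ni; rewrite xj // xyj //; lia.
(* Windows that occur in no point of [X] receive the default letter [a0]. *)
pose g (x : config k) : 'I_k :=
  xget a0 [set a | exists2 y : X, agree n x (val y) & a = val (b y) 0].
have gE (x : X) : g (val x) = val (b x) 0.
  rewrite /g; case: xgetP => [a _ [y xy ->]|/(_ (val (b x) 0))[]].
    exact/esym/bn.
  by exists x.
exists g.
  exists n => x x' xx'; rewrite /g; congr xget; apply/seteqP.
  by split=> a [y xy ->]; exists y => // i ni; rewrite -xy // xx'.
move=> x; apply/funext => i; rewrite /ca.
have xi : subshift_set X (shift i (val x)) by apply/subshift_shift/set_valP.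
rewrite -[shift i (val x)]/(val (SigSub (mem_set xi) : X)) gE.
by rewrite (bshift x (SigSub (mem_set xi)) i erefl) /shift add0r.
Qed.

Lemma vn_regular_local (f : End X) : (0 < k)%N ->
  vn_regular f <-> exists g : config k -> 'I_k, [/\ locl g,
    forall x, subshift_set X x -> subshift_set X (ca g x) &
    forall x : X, forall y : X, val y = ca g (val (f x)) -> f y = f x].
Proof.
move=> k0; split.
  move=> [b [fbf _]]; have [g lg gE] := End_local b k0.
  exists g; split => // [x Xx|x y yE].
    by have := set_valP (b (SigSub (mem_set Xx))); rewrite gE.
  have -> : y = b (f x) by apply: val_inj; rewrite gE.
  exact: (congr1 (fun h : End X => h x) fbf).
move=> [g [lg gX fgf]]; have [b bE] := local_End lg gX.
have e x : f (b (f x)) = f x by apply: fgf.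
(* From [f b f = f], the product [b f b] satisfies both equations of a generalized inverse. *)
exists (End_comp (End_comp b f) b); split; apply: End_eq => x /=; by rewrite !e.
Qed.

End Endomorphisms.

(** * Section tables and certificates for a subshift of finite type *)

Section PathCompactness.
Variables (S A : finType) (E : rel S) (lam : S -> A).
Local Open Scope ring_scope.

Lemma finite_cluster (y : nat -> int -> S) : exists x : int -> S,
  forall n N, exists2 j, (N <= j)%N & agree n x (y j).
Proof.
have [x xP] := config_cluster (fun j i => enum_rank (y j i) : 'I_#|S|).
exists (fun i => enum_val (x i)) => n N; have [j Nj xj] := xP n N.
by exists j => // i im; rewrite xj // enum_rankK.
Qed.

(** Compactness: paths over ever larger windows cluster at a path over the whole line. *)
Lemma path_of_walks (y : int -> A) :
  (forall n : nat, exists p : int -> S, forall i : int, (`|i| <= n)%N ->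
     E (p i) (p (i + 1)) /\ lam (p i) = y i) ->
  exists p : int -> S, (forall i, E (p i) (p (i + 1))) /\ forall i, lam (p i) = y i.
Proof.
move=> /choice[p pP]; have [x xP] := finite_cluster p; exists x.
suff h i : E (x i) (x (i + 1)) /\ lam (x i) = y i by split=> i; have [] := h i.
have [j ij xj] := xP `|i|.+1%N `|i|.+1%N.
have [|e l] := pP j i; first by lia.
by rewrite !xj //; lia.
Qed.

End PathCompactness.

(** * Configurations periodic on the left and on the right *)

Section BiPeriodic.
Variables (A : finType) (a0 : A).
Local Open Scope ring_scope.

Definition per (u : seq A) : int -> A :=
  fun i => nth a0 u (absz (i %% (size u)%:Z)%Z).

(* The configuration ...uuu w vvv..., with [w] starting at position 0. *)
Definition biper (u w v : seq A) : int -> A := fun i =>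
  if i < 0 then per u i
  else if (absz i < size w)%N then nth a0 w (absz i)
  else per v (i - (size w)%:Z).

Lemma biper0 u : biper u [::] u = per u.
Proof. by apply/funext => i; rewrite /biper subr0 ltn0 if_same. Qed.

Lemma perD u i (n : int) : per u (i + n * (size u)%:Z) = per u i.
Proof. by rewrite /per addrC modzMDl. Qed.

Lemma per_nth u (j : nat) : (j < size u)%N -> per u j%:Z = nth a0 u j.
Proof. by move=> ju; rewrite /per modz_small ?absz_nat //; lia. Qed.

(** The origin of the second clause of [section_table]. *)
Lemma shift_per a w : shift 1 (per (a :: w)) = per (rcons w a).
Proof.
apply/funext => i; rewrite /shift /per size_rcons /=.
set n := (size w).+1; set k := absz (i %% n)%Z.
have nz : n%:Z != 0 by [].
have kE : k%:Z = (i %% n)%Z by rewrite /k; have := modz_ge0 i nz; lia.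
have kn : (k < n)%N by have := ltz_pmod i (d := n); lia.
have -> : i + 1 = (i %/ n)%Z * n + k.+1%:Z by rewrite {1}(divz_eq i n) -kE; lia.
rewrite modzMDl nth_rcons; case: (ltngtP k (size w)) => kw.
- by rewrite modz_small ?absz_nat //; lia.
- by move: kn; rewrite /n; lia.
- by rewrite kw -/n modzz.
Qed.

Lemma biper_left u w v (n : nat) (j : int) : j < (n * size u)%N%:Z ->
  biper u w v (j - (n * size u)%N%:Z) = per u j.
Proof.
move=> jn; rewrite /biper ifT; last by lia.
by rewrite PoszM -mulNr perD.
Qed.

Lemma biper_right u w v (n : nat) (j : int) : 0 <= j + (n * size v)%N%:Z ->
  biper u w v (j + ((size w)%:Z + (n * size v)%N%:Z)) = per v j.
Proof.
move=> jn; rewrite /biper ifF ?ifF; [|lia|lia].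
rewrite -(perD v j n%:Z); congr per; lia.
Qed.

Notation bword := (pword (S := A) id).

Lemma bword_mid u w v : bword (biper u w v) 0 (size w) = w.
Proof.
apply: (@eq_from_nth _ a0); rewrite size_pword // => j jw.
rewrite nth_pword // add0r /biper (_ : (j%:Z < 0) = false) //.
by rewrite absz_nat jw.
Qed.

Variables (S : finType) (E : rel S) (lam : S -> A).
Notation rl := (rlab E lam).

Lemma bword_per u : bword (per u) 0 (size u) = u.
Proof.
apply: (@eq_from_nth _ a0); rewrite size_pword // => j jw.
by rewrite nth_pword // add0r per_nth.
Qed.

Lemma rl_per u n : rl (bword (per u) 0 (n * size u)) = relpow (rl u) n.
Proof.
elim: n => [|n IHn]; first by [].
rewrite mulSn pword_cat rlab_cat bword_per add0r /= -IHn; congr (relcomp _ (rl _)).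
apply: eq_pword => j _.
by rewrite add0r addrC -[X in j%:Z + X]mul1r perD.
Qed.

(** Idempotence allows repeating [u] and [v] at will, so arbitrarily wide windows keep the relation
    of [u ++ w ++ v]. *)
Lemma rl_biper u w v n : good_word E lam u -> good_word E lam v -> (0 < n)%N ->
  rl (bword (biper u w v) (- (n * size u)%N%:Z)
       (n * size u + (size w + n * size v))) = rl (u ++ w ++ v).
Proof.
move=> /and3P[u0 /eqP iu _] /and3P[v0 /eqP iv _] n0.
have pw (r : {set S * S}) : relcomp r r = r -> relpow r n = r.
  by move=> rr; rewrite -[n]mul1n relpow_idem_mul //= relcompr1.
rewrite !pword_cat !rlab_cat addNr bword_mid add0r; congr (relcomp _ (relcomp _ _)).
  rewrite -[RHS](pw _ iu) -rl_per -[in LHS](add0r (- _)) -pword_shift; congr (rl _).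
  apply/eq_in_map => j; rewrite mem_iota => jn.
  by rewrite add0r /shift biper_left //; lia.
rewrite -[RHS](pw _ iv) -rl_per -[in LHS](add0r (size w)%:Z) -pword_shift; congr (rl _).
apply/eq_in_map => j; rewrite mem_iota => jn.
by rewrite add0r /shift -[in LHS](addr0 (size w)%:Z) (@biper_right u w v 0).
Qed.

Lemma biper_image u w v : good_word E lam u -> good_word E lam v ->
  inhab (rl (u ++ w ++ v)) ->
  exists p : int -> S, (forall i, E (p i) (p (i + 1))) /\
    forall i, lam (p i) = biper u w v i.
Proof.
move=> gu gv h; apply: path_of_walks => n.
have /and3P[u0 _ _] := gu; have /and3P[v0 _ _] := gv.
have nu : (n.+1 <= n.+1 * size u)%N by rewrite leq_pmulr.
have nv : (n.+1 <= n.+1 * size v)%N by rewrite leq_pmulr.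
move: h; rewrite -(rl_biper w gu gv (ltn0Sn n)) => /inhabP[s [t]].
move=> /rlabP[q [[_ _ Eq] lq]]; rewrite size_pword in Eq lq.
exists (fun i => q (absz (i + (n.+1 * size u)%N%:Z)%R)) => i ni.
have k1 : (absz (i + (n.+1 * size u)%N%:Z)%R <
           n.+1 * size u + (size w + n.+1 * size v))%N by lia.
split.
  have -> : absz (i + 1 + (n.+1 * size u)%N%:Z)%R =
           (absz (i + (n.+1 * size u)%N%:Z)%R).+1 by lia.
  exact: Eq.
by rewrite (lq _ a0 k1) nth_pword //; congr biper; lia.
Qed.

End BiPeriodic.

Section Avoidance.
Variables (k : nat) (F : seq (seq 'I_k)).
Local Open Scope ring_scope.

Definition avoids (z : nat -> 'I_k) (n : nat) : bool :=
  all (fun w => all (fun i => (i + size w <= n)%N ==>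
    ([seq z (i + l)%N | l <- iota 0 (size w)] != w)) (iota 0 n.+1)) F.

Lemma avoidsP z n : reflect (forall w i, w \in F -> (i + size w <= n)%N ->
  [seq z (i + l)%N | l <- iota 0 (size w)] <> w) (avoids z n).
Proof.
apply: (iffP allP) => [h w i wF iw|h w wF].
  have /allP/(_ i) := h w wF; rewrite mem_iota iw /= => /(_ _)/eqP; apply; lia.
apply/allP => i _; apply/implyP => iw; apply/eqP; exact: h.
Qed.

Lemma avoids_config x i n : avoiding F x -> avoids (fun j => x (i + j%:Z)) n.
Proof.
move=> Fx; apply/avoidsP => w j wF _ e; apply: (Fx w wF).
exists (i + j%:Z); rewrite -[RHS]e; apply: eq_map => l.
by rewrite PoszD addrA.
Qed.

Lemma eq_avoids z z' n : (forall i, (i < n)%N -> z i = z' i) ->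
  avoids z n = avoids z' n.
Proof.
move=> zz'; apply: eq_all => w; apply: eq_in_all => i _.
have [iw|//] := leqP (i + size w) n; congr (_ ==> (_ != _)).
by apply/eq_in_map => l; rewrite mem_iota => lw; apply: zz'; lia.
Qed.

End Avoidance.

(** * The graph of windows of a subshift of finite type *)

Section SFTStates.
Variables (k : nat) (a0 : 'I_k) (F : seq (seq 'I_k)) (r m : nat).
Variable phi : {ffun r.*2.+1.-tuple 'I_k -> 'I_k}.
Hypothesis r_le_m : (r.*2.+1 <= m)%N.
Hypothesis F_le_m : forall w, w \in F -> (size w <= m)%N.
Local Open Scope ring_scope.
Notation avoids := (avoids F).
Notation S := (m.-tuple 'I_k).
Notation conf := (int -> 'I_k).

Definition letter (s : S) (j : nat) : 'I_k := nth a0 s j.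

(** A higher block presentation. Only the source is tested against [F]; on a bi-infinite path every
    vertex is a source. *)
Definition edge (s t : S) : bool :=
  avoids (letter s) m && all (fun j => letter s j.+1 == letter t j) (iota 0 m.-1).

Definition label (s : S) : 'I_k := phi [tuple letter s j | j < r.*2.+1].

Definition center (s : S) : 'I_k := letter s r.

(** The window starts at [-r]: its first [2r+1] letters determine the image at the origin, and its
    letter of index [r] sits at the origin. *)
Definition state (x : conf) : S := [tuple x (j%:Z - r%:Z) | j < m].

Definition rule (x : conf) : 'I_k := label (state x).

Lemma letter_state x j : (j < m)%N -> letter (state x) j = x (j%:Z - r%:Z).
Proof.
by move=> jm; rewrite /letter -(tnth_nth a0 (state x) (Ordinal jm)) tnth_mktuple.
Qed.

Lemma center_state x : center (state x) = x 0.
Proof. by rewrite /center letter_state ?subrr //; lia. Qed.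

Lemma locl_state : locl state.
Proof.
exists (r + m)%N => x x' xx'; apply: eq_from_tnth => j; rewrite !tnth_mktuple.
by apply: xx'; have := ltn_ord j; lia.
Qed.

Lemma locl_rule : locl rule.
Proof. exact: locl_comp locl_state. Qed.

Lemma avoids_state x : avoids (letter (state x)) m =
  avoids (fun j => x (- r%:Z + j%:Z)) m.
Proof. by apply: eq_avoids => j jm; rewrite letter_state // addrC. Qed.

Lemma config_states x : avoiding F x <->
  forall i, avoids (letter (state (shift i x))) m.
Proof.
split=> [Fx i|h w wF [i wx]].
  rewrite avoids_state /shift (@eq_avoids _ F _ (fun j => x (i - r%:Z + j%:Z))).
    exact: avoids_config.
  by move=> j _; congr x; lia.
have := h (i + r%:Z); rewrite avoids_state => /avoidsP/(_ w 0%N wF (F_le_m wF)).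
apply; rewrite -[RHS]wx; apply: eq_map => j; rewrite /shift; congr x; lia.
Qed.

Lemma state_overlap x : all (fun j => letter (state x) j.+1 ==
  letter (state (shift 1 x)) j) (iota 0 m.-1).
Proof.
apply/allP => j; rewrite mem_iota => jm; rewrite !letter_state; [|lia|lia].
by apply/eqP; rewrite /shift; congr x; lia.
Qed.

Lemma state_path x : avoiding F x ->
  forall i, edge (state (shift i x)) (state (shift (i + 1) x)).
Proof.
move=> /config_states Fx i; rewrite /edge Fx /=.
by have := state_overlap (shift i x); rewrite shiftD [1 + i]addrC.
Qed.

(** By the overlaps, each letter of a vertex is the central letter of another vertex of the path, so
    paths are the sequences of windows of configurations. *)
Lemma path_state (p : int -> S) : (forall i, edge (p i) (p (i + 1))) ->
  let x := fun i => center (p i) in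
  avoiding F x /\ forall i, p i = state (shift i x).
Proof.
move=> Ep x.
have move d i j : (j + d < m)%N -> letter (p i) (j + d)%N = letter (p (i + d%:Z)) j.
  elim: d i j => [|d IHd] i j jd; first by rewrite addn0 addr0.
  have /andP[_ /allP/(_ (j + d)%N)] := Ep i.
  rewrite mem_iota addnS => /(_ _)/eqP -> //; last by lia.
  by rewrite IHd; [congr (letter (p _) j); lia|lia].
have pE i : p i = state (shift i x).
  apply: eq_from_tnth => j; rewrite tnth_mktuple (tnth_nth a0) -/(letter _ _).
  rewrite /shift /x /center; have jm := ltn_ord j; have [jr|rj] := leqP r j.
    rewrite -{1}(subnKC jr) move; last by lia.
    by congr (letter (p _) r); lia.
  rewrite -{2}(subnKC (ltnW rj)) move; last by lia.
  by congr (letter (p _) j); lia.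
split=> //; apply/config_states => i; rewrite -pE.
by have /andP[] := Ep i.
Qed.

Variable f : End (sft F).
Hypothesis f_rule : has_local_rule f phi.

Lemma f_ruleE (x : sft F) : val (f x) = ca rule (val x).
Proof.
apply/funext => i; rewrite f_rule /ca /rule /label; congr (phi _).
apply: eq_from_tnth => j; rewrite !tnth_mktuple letter_state.
  by rewrite /shift; congr (val x _); lia.
by have := ltn_ord j; lia.
Qed.

Lemma label_path (p : int -> S) y : (forall i, edge (p i) (p (i + 1))) ->
  (forall i, label (p i) = y i) -> exists x : sft F, val (f x) = y.
Proof.
move=> Ep lp; have [Fx pE] := path_state Ep.
exists (SigSub (mem_set Fx)); rewrite f_ruleE; apply/funext => i.
by rewrite /ca /rule -pE lp.
Qed.

Definition regular_witness (g : conf -> 'I_k) : Prop :=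
  [/\ locl g, forall x, avoiding F x -> avoiding F (ca g x) &
   forall x, avoiding F x -> ca rule (ca g (ca rule x)) = ca rule x].

Lemma vn_regularP : vn_regular f <-> exists g, regular_witness g.
Proof.
have k0 : (0 < k)%N := leq_ltn_trans (leq0n a0) (ltn_ord a0).
apply: (iff_trans (vn_regular_local f k0)).
split=> -[g [lg gF fg]]; exists g; split => //.
  move=> x Fx; set x' : sft F := SigSub (mem_set Fx).
  have gfx : avoiding F (ca g (ca rule x)).
    apply: gF; rewrite -[x]/(val x') -f_ruleE; exact: set_valP.
  have := fg x' (SigSub (mem_set gfx)); rewrite f_ruleE => /(_ erefl).
  by move=> /(congr1 val); rewrite !f_ruleE.
move=> x y yE; apply: val_inj; rewrite !f_ruleE yE f_ruleE; apply: fg; exact: set_valP.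
Qed.

Lemma locl_ca (X : Type) (h : conf -> X) (g : conf -> 'I_k) :
  locl h -> locl g -> locl (fun x => h (ca g x)).
Proof.
move=> [n hn] [n' gn]; exists (n + n')%N => x x' xx'; apply: hn => i ni.
by apply: gn => j jn; rewrite /shift; apply: xx'; lia.
Qed.

(** The configuration [...uuu w vvv...] lies in the image of [f], so applying [g] gives a path with
    this labelling. Far to the left and right the path passes through the vertices that [g] produces
    on the periodic configurations. *)
Lemma regular_tables g P : regular_witness g ->
  section_table edge label P (fun u => state (ca g (per a0 u))).
Proof.
move=> [lg gF fg].
have [n Gn] := locl_ca locl_state lg.
have lift u w v : good_word edge label u -> good_word edge label v ->
    inhab (rlab edge label (u ++ w ++ v)) ->
    let p i := state (shift i (ca g (biper a0 u w v))) in
    (forall i, edge (p i) (p (i + 1))) /\ forall i, label (p i) = biper a0 u w v i.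
  move=> gu gv /(biper_image a0 gu gv)[p' [Ep' lp']].
  have [x xE] := label_path Ep' lp'; have Fx := set_valP x.
  have Fy : avoiding F (biper a0 u w v) by rewrite -xE; exact: set_valP.
  split=> [i|i]; first exact/state_path/gF.
  by rewrite -[LHS]/(ca rule _ i) -xE f_ruleE fg.
split=> [u w v gu gv _ _ _ h|a w ga ga' _].
  have [Ep lp] := lift u w v gu gv h.
  have /and3P[u0 _ _] := gu; have /and3P[v0 _ _] := gv.
  have nu : (n.+1 <= n.+1 * size u)%N by rewrite leq_pmulr.
  have nv : (n.+1 <= n.+1 * size v)%N by rewrite leq_pmulr.
  (* With [n.+1] periods on each side, the windows that determine the end vertices see periodic
     parts only. *)
  rewrite -(rl_biper a0 w gu gv (ltn0Sn n)).
  pose p i := state (shift i (ca g (biper a0 u w v))).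
  have -> : state (ca g (per a0 u)) = p (- (n.+1 * size u)%N%:Z).
    rewrite /p -ca_shiftC; apply: Gn => i ni.
    by rewrite /shift biper_left //; lia.
  have -> : state (ca g (per a0 v)) =
      p (- (n.+1 * size u)%N%:Z + (n.+1 * size u + (size w + n.+1 * size v))%N%:Z).
    rewrite PoszD addrA addNr add0r /p -ca_shiftC; apply: Gn => i ni.
    by rewrite /shift PoszD biper_right //; lia.
  exact: (rl_path (pi := id) _ _ Ep lp).
(* For the second clause the configuration is purely periodic, and the edge is that of its path at
   the origin. *)
have iu : inhab (rlab edge label ((a :: w) ++ [::] ++ (a :: w))).
  by have /and3P[_ /eqP iu hu] := ga; rewrite rlab_cat iu.
have [Ep lp] := lift _ _ _ ga ga iu; rewrite biper0 in Ep lp.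
rewrite inE -shift_per /=.
have := Ep 0; rewrite shift0 add0r ca_shiftC => ->.
by have := lp 0; rewrite shift0 => ->; rewrite (@per_nth _ a0 (a :: w) 0%N) ?eqxx.
Qed.

Lemma mixing_walks : mixing (sft F) -> exists N0, forall p p' : int -> S,
  (forall i, edge (p i) (p (i + 1))) -> (forall i, edge (p' i) (p' (i + 1))) ->
  forall n, (N0 <= n)%N -> exists q, walk edge n (p 0) (p' 0) q.
Proof.
move=> mixF.
have lang (p : int -> S) : (forall i, edge (p i) (p (i + 1))) ->
    language (sft F) (p 0 : seq 'I_k).
  move=> Ep; have [Fx pE] := path_state Ep.
  exists (fun i => center (p i)) => //; exists (- r%:Z).
  rewrite size_tuple; apply: (@eq_from_nth _ a0).
    by rewrite size_map size_iota size_tuple.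
  rewrite size_map size_iota.
  move=> j jm; rewrite (nth_map 0%N) ?size_iota // nth_iota // add0n.
  by rewrite -/(letter (p 0) j) (pE 0) letter_state // /shift; congr (center (p _)); lia.
have /choice[N NP] : forall st : S * S, exists N : nat,
    language (sft F) (st.1 : seq 'I_k) -> language (sft F) (st.2 : seq 'I_k) ->
    forall n, (N <= n)%N -> exists2 w, size w = n &
      language (sft F) ((st.1 : seq 'I_k) ++ w ++ st.2).
  move=> [s t]; have [[ls lt]|nl] := pselect (language (sft F) (s : seq 'I_k) /\
      language (sft F) (t : seq 'I_k)); last by exists 0%N => ls lt; case: nl.
  by have [N NP] := mixF _ _ ls lt; exists N.
(* The mixing bounds of the finitely many pairs of vertices have a maximum. A walk of length [n]
   moves the window by [n] positions, [m] of which belong to the first vertex, leaving [n - m]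
   letters between the two. *)
exists (m + \max_(st : S * S) N st)%N => p p' Ep Ep' n Nn.
have Nst : (N (p 0, p' 0) <= n - m)%N.
  apply: leq_trans (leq_bigmax (F := N) (p 0, p' 0)) _.
  by move: Nn; set M := bigop.body _ _ _; lia.
have [w wn [x Fx [i]]] := NP (p 0, p' 0) (lang _ Ep) (lang _ Ep') (n - m)%N Nst.
rewrite /= => xw.
have xE j : (j < size (p 0%R ++ w ++ p' 0%R))%N ->
    x (i + j%:Z) = nth a0 (p 0 ++ w ++ p' 0) j.
  move=> jn; rewrite -xw /word_at (nth_map 0%N) ?size_iota ?nth_iota //.
rewrite !size_cat !size_tuple wn in xE.
exists (fun j => state (shift (i + r%:Z + j%:Z) x)); split.
- apply: eq_from_tnth => j; rewrite tnth_mktuple (tnth_nth a0) /shift.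
  rewrite (_ : _ + _ = i + j%:Z); last by lia.
  by rewrite xE ?nth_cat ?size_tuple ?ltn_ord //; have := ltn_ord j; lia.
- apply: eq_from_tnth => j; rewrite tnth_mktuple (tnth_nth a0) /shift.
  have jm := ltn_ord j.
  rewrite (_ : _ + _ = i + (n + j)%N%:Z); last by lia.
  rewrite xE; last by lia.
  rewrite !nth_cat size_tuple ifF ?wn; last by lia.
  by rewrite ifF; [congr nth; lia|lia].
- by move=> j _; rewrite -addn1 PoszD addrA; exact: state_path.
Qed.

Lemma tables_regular : mixing (sft F) ->
  (forall P, exists G, section_table edge label P G) -> exists g, regular_witness g.
Proof.
move=> mixF tables.
have [h lh hP] := graph_lift center (mixing_walks mixF) tables.
pose P (x : conf) i := state (shift i x).
exists (fun x => center (h (P x))).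
have PS x j : P (shift j x) = shift j (P x).
  by apply/funext => i; rewrite /P /shift; congr state; apply/funext => l; congr x; lia.
have Eh x : avoiding F x -> forall i, edge (P x i) (P x (i + 1)).
  by move=> Fx i; exact: state_path.
have hE x i : avoiding F x -> edge (h (P (shift i x))) (h (P (shift (i + 1) x))).
  move=> Fx; have [|e _] := hP (P (shift i x)).
    by apply: Eh; apply: (subshift_shift (X := sft F)).
  by move: e; rewrite -PS shiftD [1 + i]addrC.
split=> [|x Fx|x Fx].
- have [n hn] := lh; have [n' Sn] := locl_state.
  exists (n + n')%N => x x' xx'; congr center; apply: hn => i ni.
  by apply: Sn => j jn; rewrite /shift; apply: xx'; lia.
- by have [] := path_state (fun i => hE x i Fx).
set y := ca rule x.
have Fy : avoiding F y.
  rewrite /y -[x]/(val (SigSub (mem_set Fx) : sft F)) -f_ruleE; exact: set_valP.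
have [_ pE] := path_state (fun i => hE y i Fy).
apply/funext => i; rewrite [LHS]/ca /rule -pE.
have Fiy : avoiding F (shift i y) by apply: (subshift_shift (X := sft F)).
have [_ lab] := hP (P (shift i y)) (Eh _ Fiy).
(* The preimage [x] of [y] supplies the labelled path that the lift asks for. *)
rewrite (lab (P (shift i x))).
- by rewrite /P shift0 center_state /shift add0r.
- by apply: Eh; apply: (subshift_shift (X := sft F)).
- by move=> j; rewrite center_state /P /shift /y /ca /rule; congr (label (state _));
    apply/funext => l; rewrite /shift; congr x; lia.
Qed.

(* The identity [f g f = f] and the stability of the SFT under [g], tested at one
   position and on all words of length [2n+1] avoiding [F]. *)
Definition certifies (n : nat) (g : conf -> 'I_k) : Prop :=
  forall x : conf, avoids (fun j => x (j%:Z - n%:Z)) n.*2.+1 ->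
    avoids (fun j => ca g x j%:Z) m /\ rule (ca g (ca rule x)) = rule x.

Lemma certifies_regular n g : locl g -> certifies n g -> regular_witness g.
Proof.
move=> lg cert.
have certs x (i : int) : avoiding F x -> avoids (fun j => ca g (shift i x) j%:Z) m /\
    rule (ca g (ca rule (shift i x))) = rule (shift i x).
  move=> Fx; apply: cert; rewrite (@eq_avoids _ F _ (fun j => x (i - n%:Z + j%:Z))).
    exact: avoids_config.
  by move=> j _; rewrite /shift; congr x; lia.
split=> // x Fx.
  apply/config_states => i; rewrite avoids_state.
  have [+ _] := certs x (i - r%:Z) Fx; rewrite (@eq_avoids _ F _ (fun j =>
    shift i (ca g x) (- r%:Z + j%:Z))) // => j _.
  by rewrite /ca /shift; congr g; apply/funext => l; congr x; lia.
apply/funext => i; have [_] := certs x i Fx.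
by rewrite ca_shiftC ca_shiftC.
Qed.

(** Compactness: violations over ever larger windows would cluster at a configuration of the SFT on
    which [g] fails. *)
Lemma regular_certifies g : regular_witness g ->
  exists n0, forall n, (n0 <= n)%N -> certifies n g.
Proof.
move=> [lg gF fg]; apply: contrapT => /forallNP bad.
have /choice[ny nyP] : forall j, exists ny : nat * conf, [/\ (j <= ny.1)%N,
    avoids (fun i => ny.2 (i%:Z - ny.1%:Z)) ny.1.*2.+1 &
    ~ (avoids (fun i => ca g ny.2 i%:Z) m /\
       rule (ca g (ca rule ny.2)) = rule ny.2)].
  move=> j; apply: contrapT => /forallNP h; apply: (bad j) => n jn x ax.
  by apply: contrapT => nc; apply: (h (n, x)).
have [x xP] := config_cluster (fun j => (ny j).2).
have Fx : avoiding F x.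
  move=> w wF [i wx].
  have [j nj xj] := xP (`|i| + size w)%N (`|i| + size w)%N.
  have [jn /avoidsP ay _] := nyP j.
  apply: (ay w (absz (i + (ny j).1%:Z)%R) wF); first by lia.
  rewrite -[RHS]wx; apply/eq_in_map => l; rewrite mem_iota => lw.
  by rewrite xj; [congr ((ny j).2); lia|lia].
have [n1 h1] : locl (fun x => [seq ca g x j%:Z | j <- iota 0 m]).
  by apply: locl_map => j; exact: locl_shift.
have [n2 h2] : locl (fun x => rule (ca g (ca rule x))).
  apply: (locl_ca (h := fun x => rule (ca g x))); last exact: locl_rule.
  by apply: locl_ca => //; exact: locl_rule.
have [n3 h3] := locl_rule.
have [j nj xj] := xP (n1 + n2 + n3)%N 0%N.
have [_ _ []] := nyP j.
rewrite -(h2 x (ny j).2); last by move=> i ni; apply: xj; lia.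
rewrite -(h3 x (ny j).2); last by move=> i ni; apply: xj; lia.
split; last by have := congr1 (fun y => y 0) (fg x Fx); rewrite /ca !shift0.
rewrite -(@eq_avoids _ F (fun i => ca g x (0 + i%:Z))).
  exact/avoids_config/gF.
move=> i im; have /h1 e : agree n1 x (ny j).2 by move=> l nl; apply: xj; lia.
have := congr1 (fun s => nth a0 s i) e.
by rewrite !(nth_map 0%N) ?size_iota // !nth_iota // !add0n add0r.
Qed.

End SFTStates.

(** * Recursive functions and decidable predicates *)

Section Computable.
Implicit Types (n : nat) (rho : nat -> nat).

Definition env n rho : n.-tuple nat := [tuple rho (val i) | i < n].

(* Total recursive functions of the first [n] entries of an environment;
   environments spare the substitution lemmas that tuples would need. *)
Definition recursive n (f : (nat -> nat) -> nat) : Prop :=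
  exists p : recfun n, forall rho, computes p (env n rho) (f rho).

Lemma tnth_env n rho (i : 'I_n) : tnth (env n rho) i = rho i.
Proof. exact: tnth_mktuple. Qed.

Lemma envS n rho : env n.+1 rho = [tuple of rho 0 :: env n (fun i => rho i.+1)].
Proof.
apply: eq_from_tnth => i; rewrite tnth_env !(tnth_nth 0) /=.
case: i => -[|i] im //=.
by have := tnth_env (fun i => rho i.+1) (Ordinal (im : i < n)); rewrite (tnth_nth 0).
Qed.

Lemma thead_env n rho : thead (env n.+1 rho) = rho 0.
Proof. by rewrite envS theadE. Qed.

Lemma behead_env n rho : behead_tuple (env n.+1 rho) = env n (fun i => rho i.+1).
Proof. by rewrite envS; apply: val_inj. Qed.

Lemma rec_ext n f g : (forall rho, f rho = g rho) -> recursive n f -> recursive n g.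
Proof. by move=> fg [p pf]; exists p => rho; rewrite -fg. Qed.

Lemma rec_var n i : i < n -> recursive n (fun rho => rho i).
Proof. by move=> im; exists (Proj (Ordinal im)) => rho /=; rewrite tnth_env. Qed.

Lemma rec_comp m n g (h : nat -> (nat -> nat) -> nat) : recursive m g ->
  (forall i, i < m -> recursive n (h i)) ->
  recursive n (fun rho => g (fun i => h i rho)).
Proof.
move=> [p pg] hr.
have /choice[q qP] : forall i : 'I_m, exists q : recfun n,
    forall rho, computes q (env n rho) (h i rho) by move=> i; exact: hr.
exists (Comp p q) => rho /=; exists (env m (fun i => h i rho)); last exact: pg.
by move=> i; rewrite tnth_env.
Qed.

Lemma rec_comp1 n F a : recursive 1 (fun rho => F (rho 0)) -> recursive n a ->
  recursive n (fun rho => F (a rho)).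
Proof. by move=> Fr ar; exact: (rec_comp (h := fun=> a) Fr). Qed.

Lemma rec_succ n a : recursive n a -> recursive n (fun rho => (a rho).+1).
Proof.
apply: (rec_comp1 (F := S)); exists Succ => rho /=.
by rewrite thead_env.
Qed.

Lemma rec_const n c : recursive n (fun=> c).
Proof.
elim: c => [|c IHc]; last exact: (rec_succ IHc).
by exists (Zero n).
Qed.

Lemma rec_iteri n g a (H : nat -> nat -> (nat -> nat) -> nat) :
  recursive n g -> recursive n a ->
  recursive n.+2 (fun rho => H (rho 0) (rho 1) (fun i => rho i.+2)) ->
  recursive n (fun rho => iteri (g rho) (fun i acc => H i acc rho) (a rho)).
Proof.
move=> gr [p pa] [q qH].
(* [PrimRec] recurses on the first entry, so the number of steps is first a variable and [g] is
   substituted afterwards. *)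
have pr : recursive n.+1 (fun rho => iteri (rho 0)
    (fun i acc => H i acc (fun i => rho i.+1)) (a (fun i => rho i.+1))).
  exists (PrimRec p q) => rho.
  exists (fun j => iteri j (fun i acc => H i acc (fun i => rho i.+1))
                        (a (fun i => rho i.+1))); split.
  - by rewrite behead_env; exact: pa.
  - move=> j jm; set s := iteri j _ _.
    have := qH (fun i => match i with 0 => j | 1 => s | i.+2 => rho i.+1 end).
    by congr (computes q _ _); rewrite !envS; apply: val_inj.
  - by rewrite thead_env.
apply: (rec_comp (h := fun i => if i is i'.+1 then (fun rho => rho i') else g) pr).
by case=> // i im; exact: rec_var.
Qed.

Lemma rec_iter n g a (H : nat -> (nat -> nat) -> nat) :
  recursive n g -> recursive n a ->
  recursive n.+1 (fun rho => H (rho 0) (fun i => rho i.+1)) ->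
  recursive n (fun rho => iter (g rho) (fun acc => H acc rho) (a rho)).
Proof.
move=> gr ar Hr; apply: (rec_ext (f := fun rho =>
   iteri (g rho) (fun _ acc => H acc rho) (a rho))).
  by move=> rho; elim: (g rho) => //= m ->.
apply: (rec_iteri (H := fun _ => H)) => //.
apply: (rec_comp (h := fun i rho => rho i.+1) Hr) => i im; exact: rec_var.
Qed.

Lemma rec_add n a b : recursive n a -> recursive n b ->
  recursive n (fun rho => a rho + b rho).
Proof.
move=> ar br; apply: (rec_ext (f := fun rho => iter (b rho) succn (a rho))).
  by move=> rho; rewrite iter_succn.
apply: (rec_iter (H := fun acc _ => acc.+1)) => //; apply: rec_succ; exact: rec_var.
Qed.

Lemma rec_pred n a : recursive n a -> recursive n (fun rho => (a rho).-1).
Proof.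
move=> ar; apply: (rec_ext (f := fun rho => iteri (a rho) (fun i _ => i) 0)).
  by move=> rho; case: (a rho).
apply: (rec_iteri (H := fun i _ _ => i)) => //; [exact: rec_const|exact: rec_var].
Qed.

Lemma rec_sub n a b : recursive n a -> recursive n b ->
  recursive n (fun rho => a rho - b rho).
Proof.
move=> ar br; apply: (rec_ext (f := fun rho => iter (b rho) predn (a rho))).
  by move=> rho; rewrite iter_predn.
apply: (rec_iter (H := fun acc _ => acc.-1)) => //; apply: rec_pred; exact: rec_var.
Qed.

Lemma rec_mul n a b : recursive n a -> recursive n b ->
  recursive n (fun rho => a rho * b rho).
Proof.
move=> ar br; apply: (rec_ext (f := fun rho => iter (b rho) (fun x => x + a rho) 0)).
  by move=> rho; rewrite mulnC; elim: (b rho) => //= m ->; rewrite mulSn addnC.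
apply: (rec_iter (H := fun acc rho => acc + a rho)) => //; first exact: rec_const.
apply: rec_add; first exact: rec_var.
apply: (rec_comp (h := fun i rho => rho i.+1) ar) => i im; exact: rec_var.
Qed.

Lemma rec_weak n f : recursive n f -> recursive n.+1 (fun rho => f (fun i => rho i.+1)).
Proof.
by move=> fr; apply: (rec_comp (h := fun i rho => rho i.+1) fr) => i im; exact: rec_var.
Qed.

Lemma rec_exp n a b : recursive n a -> recursive n b ->
  recursive n (fun rho => a rho ^ b rho).
Proof.
move=> ar br; apply: (rec_ext (f := fun rho => iter (b rho) (fun x => a rho * x) 1)).
  by move=> rho; elim: (b rho) => //= m ->; rewrite expnS.
apply: (rec_iter (H := fun acc rho => a rho * acc)) => //; first exact: rec_const.
by apply: rec_mul; [exact: rec_weak|exact: rec_var].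
Qed.

Definition decidable n (P : (nat -> nat) -> bool) : Prop :=
  recursive n (fun rho => P rho : nat).

Lemma dec_ext n P Q : (forall rho, P rho = Q rho) -> decidable n P -> decidable n Q.
Proof. by move=> PQ; apply: rec_ext => rho; rewrite PQ. Qed.

Lemma dec_eq0 n a : recursive n a -> decidable n (fun rho => a rho == 0).
Proof.
move=> ar; apply: (rec_ext (f := fun rho => 1 - a rho)).
  by move=> rho; case: (a rho).
by apply: rec_sub => //; exact: rec_const.
Qed.

Lemma dec_le n a b : recursive n a -> recursive n b ->
  decidable n (fun rho => a rho <= b rho).
Proof. by move=> ar br; rewrite /leq; apply: dec_eq0; exact: rec_sub. Qed.

Lemma dec_neg n P : decidable n P -> decidable n (fun rho => ~~ P rho).
Proof.
by move=> Pr; apply: dec_ext (dec_eq0 Pr) => rho; case: (P rho).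
Qed.

Lemma dec_and n P Q : decidable n P -> decidable n Q ->
  decidable n (fun rho => P rho && Q rho).
Proof.
by move=> Pr Qr; apply: rec_ext (rec_mul Pr Qr) => rho; case: (P rho); case: (Q rho).
Qed.

Lemma dec_or n P Q : decidable n P -> decidable n Q ->
  decidable n (fun rho => P rho || Q rho).
Proof.
move=> Pr Qr; apply: dec_ext (dec_neg (dec_and (dec_neg Pr) (dec_neg Qr))) => rho.
by rewrite negb_and !negbK.
Qed.

Lemma dec_imp n P Q : decidable n P -> decidable n Q ->
  decidable n (fun rho => P rho ==> Q rho).
Proof.
by move=> Pr Qr; apply: dec_ext (dec_or (dec_neg Pr) Qr) => rho; rewrite implybE.
Qed.

Lemma dec_eq n a b : recursive n a -> recursive n b ->
  decidable n (fun rho => a rho == b rho).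
Proof.
move=> ar br; apply: dec_ext (dec_and (dec_le ar br) (dec_le br ar)) => rho.
by rewrite eqn_leq.
Qed.

Definition exb (m : nat) (P : nat -> bool) : bool := has P (iota 0 m).
Definition allb (m : nat) (P : nat -> bool) : bool := all P (iota 0 m).

Lemma exbP m (P : nat -> bool) : reflect (exists2 i, i < m & P i) (exb m P).
Proof.
apply: (iffP hasP) => [[i]|[i im Pi]]; first by rewrite mem_iota => im Pi; exists i.
by exists i; rewrite ?mem_iota.
Qed.

Lemma allbP m (P : nat -> bool) : reflect (forall i, i < m -> P i) (allb m P).
Proof.
apply: (iffP allP) => h i; first by move=> im; apply: h; rewrite mem_iota.
by rewrite mem_iota; apply: h.
Qed.

Lemma dec_ex n g (P : nat -> (nat -> nat) -> bool) : recursive n g ->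
  decidable n.+1 (fun rho => P (rho 0) (fun i => rho i.+1)) ->
  decidable n (fun rho => exb (g rho) (fun i => P i rho)).
Proof.
move=> gr Pr; apply: (rec_ext (f := fun rho => iteri (g rho)
   (fun i acc => ((acc != 0) || P i rho) : nat) 0)).
  move=> rho; rewrite /exb; elim: (g rho) => [|m IHm] //.
  by rewrite [LHS]/= IHm -[in RHS]addn1 iotaD has_cat /= orbF add0n; case: has.
apply: (rec_iteri (H := fun i acc rho => ((acc != 0) || P i rho) : nat)) => //.
  exact: rec_const.
apply: dec_or; first by apply/dec_neg/dec_eq0; exact: rec_var.
apply: (rec_comp (h := fun i rho => if i is i'.+1 then rho i'.+2 else rho 0) Pr).
by case=> [|i] im; exact: rec_var.
Qed.

Lemma dec_all n g (P : nat -> (nat -> nat) -> bool) : recursive n g ->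
  decidable n.+1 (fun rho => P (rho 0) (fun i => rho i.+1)) ->
  decidable n (fun rho => allb (g rho) (fun i => P i rho)).
Proof.
move=> gr Pr; have := dec_neg (dec_ex (P := fun i rho => ~~ P i rho) gr (dec_neg Pr)).
by apply: dec_ext => rho; rewrite /exb -all_predC; apply: eq_all => i /=; rewrite negbK.
Qed.

Lemma rec_count n g (P : nat -> (nat -> nat) -> bool) : recursive n g ->
  decidable n.+1 (fun rho => P (rho 0) (fun i => rho i.+1)) ->
  recursive n (fun rho => count (fun i => P i rho) (iota 0 (g rho))).
Proof.
move=> gr Pr; apply: (rec_ext (f := fun rho => iteri (g rho)
   (fun i acc => acc + P i rho) 0)).
  move=> rho; elim: (g rho) => [|m IHm] //.
  by rewrite [LHS]/= IHm -[in RHS]addn1 iotaD count_cat /= addn0 add0n.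
apply: (rec_iteri (H := fun i acc rho => acc + P i rho)) => //.
  exact: rec_const.
apply: rec_add; first exact: rec_var.
apply: (rec_comp (h := fun i rho => if i is i'.+1 then rho i'.+2 else rho 0) Pr).
by case=> [|i] im; exact: rec_var.
Qed.

Lemma count_ltn c m : count (fun i => i < c) (iota 0 m) = minn c m.
Proof.
elim: m => [|m IHm]; first by rewrite minn0.
by rewrite -addn1 iotaD count_cat IHm /=; lia.
Qed.

(** The quotient is the number of positive multiples of the divisor up to the dividend; a guard
    gives 0 for the divisor 0. *)
Lemma rec_div n a b : recursive n a -> recursive n b ->
  recursive n (fun rho => a rho %/ b rho).
Proof.
move=> ar br; apply: (rec_ext (f := fun rho => count (fun i =>
   (0 < b rho) && (i.+1 * b rho <= a rho)) (iota 0 (a rho)))).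
  move=> rho; case: (posnP (b rho)) => [->|b0].
    by rewrite divn0 /= count_pred0.
  rewrite (eq_count (a2 := fun i => i < a rho %/ b rho)) => [|i /=].
    by rewrite count_ltn; apply/minn_idPl; exact: leq_div.
  by rewrite leq_divRL.
apply: (rec_count (P := fun i rho => (0 < b rho) && (i.+1 * b rho <= a rho))) => //.
apply: dec_and; apply: dec_le; try exact: rec_const; try exact: rec_weak.
by apply: rec_mul; [apply/rec_succ/rec_var|exact: rec_weak].
Qed.

Lemma rec_mod n a b : recursive n a -> recursive n b ->
  recursive n (fun rho => a rho %% b rho).
Proof.
move=> ar br; apply: rec_ext (rec_sub ar (rec_mul (rec_div ar br) br)) => rho.
by rewrite [X in X - _](divn_eq (a rho) (b rho)) addKn.
Qed.

End Computable.

(** * Arithmetical coding of words and certificates *)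

Section Digits.
Variable k : nat.

Definition digit (c i : nat) : nat := c %/ k ^ i %% k.

(** Words are numbers in base [k], the first letter being the lowest digit; this is concatenation
    after a word of length [l]. *)
Definition catn (l a b : nat) : nat := a + b * k ^ l.

Fixpoint enc (phi : nat -> nat) (n : nat) : nat :=
  if n is n'.+1 then catn n' (enc phi n') (phi n') else 0.

Lemma eq_enc phi psi n : (forall i, i < n -> phi i = psi i) -> enc phi n = enc psi n.
Proof.
elim: n => //= n IHn e; rewrite e // IHn // => i im; apply: e; lia.
Qed.

Hypothesis k_gt0 : 0 < k.

Lemma ltn_digit c i : digit c i < k.
Proof. by rewrite ltn_mod. Qed.

Lemma digit_div c i j : digit (c %/ k ^ i) j = digit c (i + j).
Proof. by rewrite /digit -divnMA -expnD. Qed.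

Lemma digit_catr l a b j : a < k ^ l -> digit (catn l a b) (l + j) = digit b j.
Proof.
move=> al; rewrite -digit_div /catn addnC divnMDl ?expn_gt0 ?k_gt0 //.
by rewrite divn_small // addn0.
Qed.

Lemma digit_catl l a b j : j < l -> digit (catn l a b) j = digit a j.
Proof.
move=> jl; rewrite /catn /digit.
have -> : k ^ l = k ^ (l - j).-1 * k * k ^ j.
  by rewrite -expnSr -expnD; congr (_ ^ _); lia.
by rewrite addnC !mulnA divnMDl ?expn_gt0 ?k_gt0 // modnMDl.
Qed.

Lemma ltn_catn l l' a b : a < k ^ l -> b < k ^ l' -> catn l a b < k ^ (l + l').
Proof.
move=> al bl; rewrite /catn.
have : b.+1 * k ^ l <= k ^ l' * k ^ l by rewrite leq_mul2r bl orbT.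
by rewrite expnD mulSn [k ^ l * _]mulnC; lia.
Qed.

Lemma ltn_enc phi n : (forall i, i < n -> phi i < k) -> enc phi n < k ^ n.
Proof.
elim: n => [|n IHn] // phik; rewrite -[X in k ^ X]addn1.
apply: ltn_catn; rewrite ?expn1 ?phik //; apply: IHn => i im.
by apply: phik; lia.
Qed.

Lemma digit_enc phi n i : (forall i, i < n -> phi i < k) -> i < n ->
  digit (enc phi n) i = phi i.
Proof.
elim: n => // n IHn phik; rewrite ltnS leq_eqVlt => /orP[/eqP ->|im] /=.
  have en : enc phi n < k ^ n by apply: ltn_enc => j jn; apply: phik; lia.
  have := digit_catr (phi n) 0 en; rewrite addn0 => ->.
  by rewrite /digit expn0 divn1 modn_small // phik.
by rewrite digit_catl // IHn // => j jn; apply: phik; lia.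
Qed.

Lemma enc_digit c n : enc (digit c) n = c %% k ^ n.
Proof.
elim: n => [|n IHn] /=; first by rewrite modn1.
rewrite IHn /catn /digit; set q := c %/ k ^ n.
have kn : 0 < k ^ n by rewrite expn_gt0 k_gt0.
rewrite [in RHS](divn_eq c (k ^ n)) -/q {2}(divn_eq q k) mulnDl -mulnA -expnS -addnA.
have small : catn n (c %% k ^ n) (q %% k) < k ^ (n + 1).
  by apply: ltn_catn; rewrite ?expn1 ltn_mod.
by rewrite addn1 in small; rewrite modnMDl [in RHS]addnC [RHS]modn_small.
Qed.

End Digits.

Section SequenceCodes.

(** The code of a nonempty list is [2 ^ a * (2 * c + 1)], with [a] its head and [c] the code of its
    tail, so the head is the 2-adic valuation. The empty list has code 0. *)
Definition chead (c : nat) : nat := count (fun i => c %% 2 ^ i.+1 == 0) (iota 0 c).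
Definition ctail (c : nat) : nat := c %/ 2 ^ (chead c).+1.
Definition cnth (c j : nat) : nat := chead (iter j ctail c).
Definition csize (c : nat) : nat := count (fun j => iter j ctail c != 0) (iota 0 c).

Lemma code_cons a s : CodeSeq.code (a :: s) = 2 ^ a * (CodeSeq.code s).*2.+1.
Proof. by []. Qed.

Lemma ltn_code_cons a s : maxn a (CodeSeq.code s) < CodeSeq.code (a :: s).
Proof.
rewrite code_cons; have a2 := ltn_expl a (ltnSn 1).
have h1 : 2 ^ a * 1 <= 2 ^ a * (CodeSeq.code s).*2.+1 by rewrite leq_mul2l; lia.
have h2 : 1 * (CodeSeq.code s).*2.+1 <= 2 ^ a * (CodeSeq.code s).*2.+1.
  by rewrite leq_mul2r expn_gt0 orbT.
lia.
Qed.

Lemma chead_cons a s : chead (CodeSeq.code (a :: s)) = a.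
Proof.
rewrite /chead; have la := ltn_code_cons a s.
rewrite (eq_count (a2 := fun i => i < a)) => [|i]; last first.
  rewrite code_cons -/(_ %| _); have [ia|ai] := ltnP i a.
    by rewrite dvdn_mulr // dvdn_exp2l.
  rewrite -(subnKC ai) -addnS expnD dvdn_pmul2l ?expn_gt0 // expnS.
  by apply/negP => /(dvdn_trans (dvdn_mulr _ (dvdnn 2))); rewrite dvdn2 /= odd_double.
by rewrite count_ltn; apply/minn_idPl; lia.
Qed.

Lemma ctail_cons a s : ctail (CodeSeq.code (a :: s)) = CodeSeq.code s.
Proof.
rewrite /ctail chead_cons code_cons expnSr divnMl ?expn_gt0 //.
by rewrite divn2 /= uphalf_double.
Qed.

Lemma iter_ctail s j : iter j ctail (CodeSeq.code s) = CodeSeq.code (drop j s).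
Proof.
elim: j s => [|j IHj] s; first by rewrite drop0.
case: s => [|a s]; last by rewrite iterSr ctail_cons IHj.
have t0 : ctail 0 = 0 by [].
by rewrite /=; elim: j {IHj} => //= j ->.
Qed.

Lemma cnth_code s j : j < size s -> cnth (CodeSeq.code s) j = nth 0 s j.
Proof. by move=> js; rewrite /cnth iter_ctail (drop_nth 0 js) chead_cons. Qed.

Lemma size_le_code s : size s <= CodeSeq.code s.
Proof. by elim: s => //= a s IHs; have := ltn_code_cons a s; rewrite /=; lia. Qed.

Lemma csize_code s : csize (CodeSeq.code s) = size s.
Proof.
rewrite /csize (eq_count (a2 := fun j => j < size s)) => [|j].
  by rewrite count_ltn; apply/minn_idPl; exact: size_le_code.
rewrite iter_ctail; have [js|js] := ltnP j (size s); last by rewrite drop_oversize.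
by rewrite (drop_nth 0 js) -lt0n; have := ltn_code_cons (nth 0 s j) (drop j.+1 s); lia.
Qed.

Lemma mem_le_code s a : a \in s -> a < CodeSeq.code s.
Proof.
elim: s => // b s IHs; have := ltn_code_cons b s.
rewrite gtn_max => /andP[bs ss]; rewrite inE => /orP[/eqP -> //|/IHs as'].
exact: ltn_trans ss.
Qed.

End SequenceCodes.

Section Predicates.
Variables k Fc r tab m : nat.

Definition avoidsn (z n off : nat) : bool :=
  allb (csize Fc) (fun a => allb n.+1 (fun i => (i + csize (cnth Fc a) <= n) ==>
    ~~ allb (csize (cnth Fc a)) (fun l =>
         digit k z (off + (i + l)) == cnth (cnth Fc a) l))).

Definition labn (z i a : nat) : bool :=
  exb (csize tab) (fun j =>
    allb (r + r).+1 (fun l => cnth (cnth tab j) l == digit k z (i + l)) &&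
    (cnth (cnth tab j) (r + r).+1 == a)).

(** A walk of length [l] between windows of length [m] is one word [z] of [l + m] letters, beginning
    and ending with the two vertices. *)
Definition reln (l w s t : nat) : bool :=
  exb (k ^ (l + m)) (fun z =>
    [&& allb m (fun j => digit k z j == digit k s j),
        allb m (fun j => digit k z (l + j) == digit k t j) &
        allb l (fun i => avoidsn z m i && labn z i (digit k w i))]).

Definition inhabn (l w : nat) : bool :=
  exb (k ^ m) (fun s => exb (k ^ m) (fun t => reln l w s t)).

Definition goodn (l u : nat) : bool :=
  [&& 0 < l, allb (k ^ m) (fun s => allb (k ^ m) (fun t =>
        (reln (l + l) (catn k l u u) s t : nat) == reln l u s t)) & inhabn l u].

(* The table [G] is a number written in base [k ^ m], its digits being the codes of
   the vertices. *)
Definition lookup (P G l u : nat) : nat := digit (k ^ m) G (u * P.+1 + l).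

Definition critn (P : nat) : bool :=
  exb ((k ^ m) ^ (k ^ P * P.+1)) (fun G =>
    allb P.+1 (fun lu => allb (k ^ lu) (fun u =>
    allb P.+1 (fun lv => allb (k ^ lv) (fun v =>
    allb P.+1 (fun lw => allb (k ^ lw) (fun w =>
      [&& goodn lu u, goodn lv v &
          inhabn (lu + (lw + lv)) (catn k lu u (catn k lw w v))] ==>
      reln (lu + (lw + lv)) (catn k lu u (catn k lw w v))
        (lookup P G lu u) (lookup P G lv v))))))) &&
    allb P (fun l => allb (k ^ l) (fun w => allb k (fun a =>
      goodn l.+1 (catn k 1 a w) && goodn l.+1 (catn k l w a) ==>
      reln 1 a (lookup P G l.+1 (catn k 1 a w)) (lookup P G l.+1 (catn k l w a)))))).

(** [Gam] lists the values of a local rule of radius [R], indexed by the words of length [2R+1]; the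
    one used here starts at index [i] of [z]. *)
Definition gamma (Gam R z i : nat) : nat :=
  digit k Gam ((z %/ k ^ i) %% k ^ (R + R).+1).

(** With [g] the rule coded by [Gam], [v] stands for the image of [z] under [g], [a] for that under
    the automaton, and [b] for the image of [a] under [g]. They are quantified over and constrained
    digit by digit. The origin has index [n] in [z], [n - r] in [a] and [n - r - R] in [b]. *)
Definition certn (R Gam n : nat) : bool :=
  allb (k ^ (n + n).+1) (fun z => avoidsn z (n + n).+1 0 ==>
    allb (k ^ m) (fun v =>
      allb m (fun i => digit k v i == gamma Gam R z (n - R + i)) ==> avoidsn v m 0) &&
    allb (k ^ (n + n).+1) (fun a => allb (k ^ (n + n).+1) (fun b =>
      allb (n + n).+1 (fun i => (i + (r + r) <= n + n) ==> labn z i (digit k a i)) &&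
      allb (n + n).+1 (fun i => (i + (r + r + (R + R)) <= n + n) ==>
         (digit k b i == gamma Gam R a i)) ==>
      labn b (n - (R + (r + r))) (digit k a (n - r))))).

(** One number bounds the radius, the table and the extra width, so that the search has a single
    variable. *)
Definition certificate (c : nat) : bool :=
  exb c.+1 (fun R => exb c.+1 (fun Gam => exb c.+1 (fun e =>
    certn R Gam (e + (m + (R + (r + r))))))).

End Predicates.

(** * Recursiveness of the coded predicates *)

Ltac rec_step := lazymatch goal with
  | |- recursive _ (fun _ => ?c) => exact: rec_const
  | |- recursive _ (fun rho => rho ?i) => by apply: rec_var
  | |- recursive ?n (fun rho => nat_of_bool (@?P rho)) => change (decidable n P)
  | |- recursive _ (fun rho => (@?a rho).+1) => apply: (rec_succ (a := a))
  | |- recursive _ (fun rho => @?a rho + @?b rho) => apply: (rec_add (a := a) (b := b))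
  | |- recursive _ (fun rho => @?a rho * @?b rho) => apply: (rec_mul (a := a) (b := b))
  | |- recursive _ (fun rho => @?a rho - @?b rho) => apply: (rec_sub (a := a) (b := b))
  | |- recursive _ (fun rho => @?a rho ^ @?b rho) => apply: (rec_exp (a := a) (b := b))
  | |- recursive _ (fun rho => @?a rho %/ @?b rho) => apply: (rec_div (a := a) (b := b))
  | |- recursive _ (fun rho => @?a rho %% @?b rho) => apply: (rec_mod (a := a) (b := b))
  | |- decidable _ (fun rho => @?P rho && @?Q rho) => apply: (dec_and (P := P) (Q := Q))
  | |- decidable _ (fun rho => @?P rho || @?Q rho) => apply: (dec_or (P := P) (Q := Q))
  | |- decidable _ (fun rho => @?P rho ==> @?Q rho) => apply: (dec_imp (P := P) (Q := Q))
  | |- decidable _ (fun rho => ~~ @?P rho) => apply: (dec_neg (P := P))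
  | |- decidable _ (fun rho => @?a rho <= @?b rho) => apply: (dec_le (a := a) (b := b))
  | |- decidable _ (fun rho => @?a rho == @?b rho) => apply: (dec_eq (a := a) (b := b))
  | |- decidable _ (fun rho => exb _ _) => apply: dec_ex
  | |- decidable _ (fun rho => allb _ _) => apply: dec_all
  end; cbv beta.

Lemma rec_digit n k c i :
  recursive n k -> recursive n c -> recursive n i ->
  recursive n (fun rho => digit (k rho) (c rho) (i rho)).
Proof.
move=> *; apply: (rec_comp (m := 3) (g := fun rho => digit (rho 0) (rho 1) (rho 2))
  (h := fun ix => nth (fun=> 0) [:: k; c; i] ix)); last by do 3?case.
by rewrite /digit; do ?rec_step.
Qed.

Lemma rec_catn n k l a b :
  recursive n k -> recursive n l -> recursive n a -> recursive n b ->
  recursive n (fun rho => catn (k rho) (l rho) (a rho) (b rho)).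
Proof.
move=> *; apply: (rec_comp (m := 4)
  (g := fun rho => catn (rho 0) (rho 1) (rho 2) (rho 3))
  (h := fun ix => nth (fun=> 0) [:: k; l; a; b] ix)); last by do 4?case.
by rewrite /catn; do ?rec_step.
Qed.

Lemma rec_chead n c :
  recursive n c ->
  recursive n (fun rho => chead (c rho)).
Proof.
move=> *; apply: (rec_comp (m := 1) (g := fun rho => chead (rho 0))
  (h := fun ix => nth (fun=> 0) [:: c] ix)); last by do 1?case.
by apply: (rec_count (P := fun i rho => rho 0 %% 2 ^ i.+1 == 0)); do ?rec_step.
Qed.

Lemma rec_ctail n c :
  recursive n c ->
  recursive n (fun rho => ctail (c rho)).
Proof.
move=> *; apply: (rec_comp (m := 1) (g := fun rho => ctail (rho 0))
  (h := fun ix => nth (fun=> 0) [:: c] ix)); last by do 1?case.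
by rewrite /ctail; do ?[rec_step | apply: rec_chead].
Qed.

Lemma rec_cnth n c j :
  recursive n c -> recursive n j ->
  recursive n (fun rho => cnth (c rho) (j rho)).
Proof.
move=> *; apply: (rec_comp (m := 2) (g := fun rho => cnth (rho 0) (rho 1))
  (h := fun ix => nth (fun=> 0) [:: c; j] ix)); last by do 2?case.
by apply/rec_chead/(rec_iter (H := fun c _ => ctail c)); do ?[rec_step | apply: rec_ctail].
Qed.

Lemma rec_csize n c :
  recursive n c ->
  recursive n (fun rho => csize (c rho)).
Proof.
move=> *; apply: (rec_comp (m := 1) (g := fun rho => csize (rho 0))
  (h := fun ix => nth (fun=> 0) [:: c] ix)); last by do 1?case.
apply: (rec_count (P := fun j rho => iter j ctail (rho 0) != 0)); first by rec_step.
apply/dec_neg/dec_eq; last by rec_step.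
by apply: (rec_iter (H := fun c _ => ctail c)); do ?[rec_step | apply: rec_ctail].
Qed.

Lemma dec_avoidsn n k Fc z l off :
  recursive n k -> recursive n Fc -> recursive n z -> recursive n l ->
  recursive n off ->
  decidable n (fun rho => avoidsn (k rho) (Fc rho) (z rho) (l rho) (off rho)).
Proof.
move=> *; apply: (rec_comp (m := 5)
  (g := fun rho => avoidsn (rho 0) (rho 1) (rho 2) (rho 3) (rho 4) : nat)
  (h := fun ix => nth (fun=> 0) [:: k; Fc; z; l; off] ix)); last by do 5?case.
by rewrite /avoidsn; do ?[rec_step | apply: rec_csize | apply: rec_cnth | apply: rec_digit].
Qed.

Lemma dec_labn n k r tab z i a :
  recursive n k -> recursive n r -> recursive n tab -> recursive n z ->
  recursive n i -> recursive n a ->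
  decidable n (fun rho => labn (k rho) (r rho) (tab rho) (z rho) (i rho) (a rho)).
Proof.
move=> *; apply: (rec_comp (m := 6)
  (g := fun rho => labn (rho 0) (rho 1) (rho 2) (rho 3) (rho 4) (rho 5) : nat)
  (h := fun ix => nth (fun=> 0) [:: k; r; tab; z; i; a] ix)); last by do 6?case.
by rewrite /labn; do ?[rec_step | apply: rec_csize | apply: rec_cnth | apply: rec_digit].
Qed.

Lemma rec_lookup n k m P G l u :
  recursive n k -> recursive n m -> recursive n P -> recursive n G ->
  recursive n l -> recursive n u ->
  recursive n (fun rho => lookup (k rho) (m rho) (P rho) (G rho) (l rho) (u rho)).
Proof.
move=> *; apply: (rec_comp (m := 6)
  (g := fun rho => lookup (rho 0) (rho 1) (rho 2) (rho 3) (rho 4) (rho 5))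
  (h := fun ix => nth (fun=> 0) [:: k; m; P; G; l; u] ix)); last by do 6?case.
by rewrite /lookup; do ?[rec_step | apply: rec_digit].
Qed.

Lemma rec_gamma n k Gam R z i :
  recursive n k -> recursive n Gam -> recursive n R -> recursive n z -> recursive n i ->
  recursive n (fun rho => gamma (k rho) (Gam rho) (R rho) (z rho) (i rho)).
Proof.
move=> *; apply: (rec_comp (m := 5)
  (g := fun rho => gamma (rho 0) (rho 1) (rho 2) (rho 3) (rho 4))
  (h := fun ix => nth (fun=> 0) [:: k; Gam; R; z; i] ix)); last by do 5?case.
by rewrite /gamma; do ?[rec_step | apply: rec_digit].
Qed.

Lemma dec_reln n k Fc r tab m l w s t :
  recursive n k -> recursive n Fc -> recursive n r -> recursive n tab ->
  recursive n m -> recursive n l -> recursive n w -> recursive n s -> recursive n t ->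
  decidable n (fun rho => reln
    (k rho) (Fc rho) (r rho) (tab rho) (m rho) (l rho) (w rho) (s rho) (t rho)).
Proof.
move=> *; apply: (rec_comp (m := 9)
  (g := fun rho => reln
    (rho 0) (rho 1) (rho 2) (rho 3) (rho 4) (rho 5) (rho 6) (rho 7) (rho 8) : nat)
  (h := fun ix => nth (fun=> 0) [:: k; Fc; r; tab; m; l; w; s; t] ix)); last by do 9?case.
by rewrite /reln; do ?[rec_step | apply: dec_avoidsn | apply: dec_labn | apply: rec_digit].
Qed.

Lemma dec_inhabn n k Fc r tab m l w :
  recursive n k -> recursive n Fc -> recursive n r -> recursive n tab ->
  recursive n m -> recursive n l -> recursive n w ->
  decidable n (fun rho => inhabn
    (k rho) (Fc rho) (r rho) (tab rho) (m rho) (l rho) (w rho)).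
Proof.
move=> *; apply: (rec_comp (m := 7)
  (g := fun rho => inhabn (rho 0) (rho 1) (rho 2) (rho 3) (rho 4) (rho 5) (rho 6) : nat)
  (h := fun ix => nth (fun=> 0) [:: k; Fc; r; tab; m; l; w] ix)); last by do 7?case.
by rewrite /inhabn; do ?[rec_step | apply: dec_reln].
Qed.

Lemma dec_goodn n k Fc r tab m l u :
  recursive n k -> recursive n Fc -> recursive n r -> recursive n tab ->
  recursive n m -> recursive n l -> recursive n u ->
  decidable n (fun rho => goodn
    (k rho) (Fc rho) (r rho) (tab rho) (m rho) (l rho) (u rho)).
Proof.
move=> *; apply: (rec_comp (m := 7)
  (g := fun rho => goodn (rho 0) (rho 1) (rho 2) (rho 3) (rho 4) (rho 5) (rho 6) : nat)
  (h := fun ix => nth (fun=> 0) [:: k; Fc; r; tab; m; l; u] ix)); last by do 7?case.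
by rewrite /goodn; do ?[rec_step | apply: dec_reln | apply: dec_inhabn | apply: rec_catn].
Qed.

Lemma dec_critn n k Fc r tab m P :
  recursive n k -> recursive n Fc -> recursive n r -> recursive n tab ->
  recursive n m -> recursive n P ->
  decidable n (fun rho => critn (k rho) (Fc rho) (r rho) (tab rho) (m rho) (P rho)).
Proof.
move=> *; apply: (rec_comp (m := 6)
  (g := fun rho => critn (rho 0) (rho 1) (rho 2) (rho 3) (rho 4) (rho 5) : nat)
  (h := fun ix => nth (fun=> 0) [:: k; Fc; r; tab; m; P] ix)); last by do 6?case.
by rewrite /critn; do ?[rec_step | apply: dec_goodn | apply: dec_inhabn
  | apply: dec_reln | apply: rec_catn | apply: rec_lookup].
Qed.

Lemma dec_certn n k Fc r tab m R Gam l :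
  recursive n k -> recursive n Fc -> recursive n r -> recursive n tab ->
  recursive n m -> recursive n R -> recursive n Gam -> recursive n l ->
  decidable n (fun rho => certn
    (k rho) (Fc rho) (r rho) (tab rho) (m rho) (R rho) (Gam rho) (l rho)).
Proof.
move=> *; apply: (rec_comp (m := 8)
  (g := fun rho => certn
    (rho 0) (rho 1) (rho 2) (rho 3) (rho 4) (rho 5) (rho 6) (rho 7) : nat)
  (h := fun ix => nth (fun=> 0) [:: k; Fc; r; tab; m; R; Gam; l] ix)); last by do 8?case.
by rewrite /certn; do ?[rec_step | apply: dec_avoidsn | apply: dec_labn
  | apply: rec_gamma | apply: rec_digit].
Qed.

Lemma dec_certificate n k Fc r tab m c :
  recursive n k -> recursive n Fc -> recursive n r -> recursive n tab ->
  recursive n m -> recursive n c ->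
  decidable n (fun rho => certificate (k rho) (Fc rho) (r rho) (tab rho) (m rho) (c rho)).
Proof.
move=> *; apply: (rec_comp (m := 6)
  (g := fun rho => certificate (rho 0) (rho 1) (rho 2) (rho 3) (rho 4) (rho 5) : nat)
  (h := fun ix => nth (fun=> 0) [:: k; Fc; r; tab; m; c] ix)); last by do 6?case.
by rewrite /certificate; do ?[rec_step | apply: dec_certn].
Qed.

(** * Meaning of the arithmetical predicates *)

Section CodeWords.
Variable k : nat.
Implicit Types (s : seq (seq 'I_k)) (w : seq 'I_k).

Lemma csize_words s : csize (code_words s) = size s.
Proof. by rewrite csize_code size_map. Qed.

Lemma cnth_words s j : j < size s ->
  cnth (code_words s) j = CodeSeq.code [seq val a | a <- nth [::] s j].
Proof. by move=> js; rewrite cnth_code ?size_map // (nth_map [::]). Qed.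

Lemma csize_word w : csize (CodeSeq.code [seq val a | a <- w]) = size w.
Proof. by rewrite csize_code size_map. Qed.

Lemma cnth_word a0 w l : l < size w ->
  cnth (CodeSeq.code [seq val a | a <- w]) l = nth a0 w l :> nat.
Proof. by move=> lw; rewrite cnth_code ?size_map // (nth_map a0). Qed.

Lemma size_le_words s w : w \in s -> size w <= code_words s.
Proof.
move=> ws; have := size_le_code [seq val a | a <- w]; rewrite size_map => h.
apply: leq_trans h (ltnW (mem_le_code _)).
by apply/mapP; exists w.
Qed.

End CodeWords.

Section Letters.
Variables (k : nat) (a0 : 'I_k).

Let k_gt0 : 0 < k := leq_ltn_trans (leq0n a0) (ltn_ord a0).

Definition ord (n : nat) : 'I_k := insubd a0 n.

Lemma val_ord n : n < k -> ord n = n :> nat.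
Proof. by move=> nk; rewrite /ord val_insubd nk. Qed.

Lemma ord_val (a : 'I_k) : ord a = a.
Proof. by apply: val_inj; rewrite /= val_ord. Qed.

Lemma ord_digit c i : ord (digit k c i) = digit k c i :> nat.
Proof. by rewrite val_ord // ltn_digit. Qed.

Definition wd (l c : nat) : seq 'I_k := [seq ord (digit k c i) | i <- iota 0 l].

Lemma size_wd l c : size (wd l c) = l.
Proof. by rewrite size_map size_iota. Qed.

Lemma nth_wd l c i : i < l -> nth a0 (wd l c) i = ord (digit k c i).
Proof. by move=> il; rewrite (nth_map 0) ?size_iota // nth_iota. Qed.

Lemma wd_surj (w : seq 'I_k) : exists2 c, c < k ^ size w & wd (size w) c = w.
Proof.
have wk i : i < size w -> nth a0 w i < k by move=> _; exact: ltn_ord.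
exists (enc k (fun i => nth a0 w i) (size w)); first exact: ltn_enc.
apply: (@eq_from_nth _ a0); rewrite size_wd // => i iw.
by rewrite nth_wd // digit_enc // ord_val.
Qed.

Lemma wd_cat l l' c c' : c < k ^ l -> wd (l + l') (catn k l c c') = wd l c ++ wd l' c'.
Proof.
move=> ck; rewrite /wd iotaD map_cat add0n -[X in iota X l']addn0 iotaDl -map_comp.
congr (_ ++ _); last by apply: eq_map => j /=; rewrite digit_catr.
by apply/eq_in_map => j; rewrite mem_iota => jl; rewrite digit_catl.
Qed.

Definition word_code (w : seq 'I_k) : nat := enc k (fun i => nth a0 w i) (size w).

Lemma ltn_word_code w : word_code w < k ^ size w.
Proof. by apply: ltn_enc => // i _; exact: ltn_ord. Qed.

Lemma word_codeK w : wd (size w) (word_code w) = w.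
Proof.
apply: (@eq_from_nth _ a0); rewrite size_wd // => i iw.
by rewrite nth_wd // (digit_enc k_gt0 (fun x _ => ltn_ord (nth a0 w x))) // ord_val.
Qed.

Lemma wdK l u : u < k ^ l -> word_code (wd l u) = u.
Proof.
move=> uk; rewrite /word_code size_wd (@eq_enc _ _ (digit k u)) => [|i il].
  by rewrite enc_digit // modn_small.
by rewrite nth_wd // ord_digit.
Qed.

Lemma wd1 c : c < k -> wd 1 c = [:: ord c].
Proof. by move=> ck; rewrite /wd /= /digit expn0 divn1 modn_small. Qed.

Definition table_rule (R Gam : nat) (x : int -> 'I_k) : 'I_k :=
  ord (digit k Gam (enc k (fun j => x (j%:Z - R%:Z)%R) (R + R).+1)).

Lemma locl_table_rule R Gam : locl (table_rule R Gam).
Proof.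
exists R => x x' xx'; rewrite /table_rule; congr (ord (digit k Gam _)).
by apply: eq_enc => j jR; rewrite xx' //; lia.
Qed.

(** A local function is determined by its values on finitely many windows; these are the digits of
    the table. *)
Lemma table_rule_surj g : locl g -> exists R Gam, table_rule R Gam = g.
Proof.
move=> [R gR]; exists R.
pose conf V (i : int) := ord (digit k V (absz (i + R%:Z)%R)).
exists (enc k (fun V => g (conf V)) (k ^ (R + R).+1)); apply/funext => x.
set V := enc k (fun j => x (j%:Z - R%:Z)%R) (R + R).+1.
have Vk : V < k ^ (R + R).+1 by apply: ltn_enc => // i _; exact: ltn_ord.
rewrite /table_rule -/V (digit_enc k_gt0 (fun V _ => ltn_ord (g (conf V)))) // ord_val.
apply: gR => i iR; rewrite /conf /V (digit_enc k_gt0 (fun j _ => ltn_ord _)); last by lia.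
by rewrite ord_val; congr x; lia.
Qed.

Definition reads (z : nat) (x : int -> 'I_k) (o : int) (len : nat) : Prop :=
  forall j, j < len -> digit k z j = x (j%:Z - o)%R :> nat.

Lemma gammaE z x o len R Gam i : reads z x o len -> i + (R + R) < len ->
  gamma k Gam R z i = table_rule R Gam (shift (i%:Z + R%:Z - o)%R x) :> nat.
Proof.
move=> zx iR; rewrite /table_rule ord_digit /gamma -enc_digit //.
congr digit; apply: eq_enc => j jR.
by rewrite digit_div // zx; [rewrite /shift; congr (nat_of_ord (x _)); lia|lia].
Qed.

End Letters.

Section Specification.
Variables (k : nat) (a0 : 'I_k) (F : seq (seq 'I_k)) (r : nat).
Variable phi : {ffun r.*2.+1.-tuple 'I_k -> 'I_k}.

Let Fc := code_words F.
Let tab := code_words (rule_table phi).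
(* The window length has to exceed [2r] and the lengths of the forbidden words; the
   latter are at most the code of their list. *)
Let m := (r + r).+1 + Fc.

Let k_gt0 : 0 < k := leq_ltn_trans (leq0n a0) (ltn_ord a0).

Lemma r_le_m : r.*2.+1 <= m.
Proof. by rewrite /m addnn leq_addr. Qed.

Lemma F_le_m w : w \in F -> size w <= m.
Proof. by move=> /size_le_words wF; apply: leq_trans wF _; exact: leq_addl. Qed.

Notation ord := (ord a0).
Notation wd := (wd a0).
Notation word_code := (word_code a0).
Notation table_rule := (table_rule a0).
Notation avoids := (avoids F).
Notation edge := (edge a0 F (m := m)).
Notation label := (label a0 phi (m := m)).
Notation rl := (rlab edge label).

Lemma avoidsnE z n off :
  avoidsn k Fc z n off = avoids (fun i => ord (digit k z (off + i))) n.
Proof.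
apply/allbP/avoidsP => [h w i wF iw|h j].
  have jF : index w F < csize Fc by rewrite csize_words index_mem.
  have := h _ jF; rewrite cnth_words ?index_mem // nth_index // csize_word.
  move=> /allbP/(_ i); rewrite iw /= => /(_ _)/negP.
  move=> /[swap] e; case; first by lia.
  apply/allbP => l lw; rewrite (cnth_word a0) // -e (nth_map 0) ?size_iota //.
  by rewrite nth_iota // ord_digit.
rewrite csize_words => jF; rewrite cnth_words // csize_word; set w := nth _ _ _.
apply/allbP => i _; apply/implyP => iw; apply/negP => /allbP e.
apply: (h w i (mem_nth _ jF) iw); apply: (@eq_from_nth _ a0).
  by rewrite size_map size_iota.
rewrite size_map size_iota => l lw; rewrite (nth_map 0) ?size_iota // nth_iota //.
by apply: val_inj => /=; rewrite ord_digit -(cnth_word a0) //; apply/eqP/e.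
Qed.

Lemma labnE z i a : labn k r tab z i a =
  (phi [tuple ord (digit k z (i + j)) | j < r.*2.+1] == a :> nat).
Proof.
set t := [tuple _ | j < _].
have szt (u : r.*2.+1.-tuple 'I_k) : size (rcons u (phi u)) = (r + r).+2.
  by rewrite size_rcons size_tuple addnn.
have tnthE l : l < (r + r).+1 -> nth a0 (rcons t (phi t)) l = ord (digit k z (i + l)).
  rewrite addnn => lr; rewrite nth_rcons size_tuple lr.
  by rewrite -(tnth_nth a0 t (Ordinal lr)) tnth_mktuple.
have last (u : r.*2.+1.-tuple 'I_k) : nth a0 (rcons u (phi u)) (r + r).+1 = phi u.
  by rewrite nth_rcons size_tuple addnn ltnn eqxx.
have rowE j : j < size (rule_table phi) -> exists u : r.*2.+1.-tuple 'I_k,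
    nth [::] (rule_table phi) j = rcons u (phi u).
  move=> js; have /mapP[u _ ->] := mem_nth [::] js; by exists u.
apply/exbP/eqP => [[j]|<-].
  rewrite csize_words => js; rewrite cnth_words //; have [u ->] := rowE j js.
  move=> /andP[/allbP e /eqP <-]; rewrite (cnth_word a0) ?szt // last.
  suff -> : u = t by [].
  apply: eq_from_tnth => l; rewrite !(tnth_nth a0).
  have lr : l < (r + r).+1 by rewrite addnn.
  have := e l lr; rewrite (cnth_word a0) ?szt //; last by lia.
  rewrite nth_rcons size_tuple ltn_ord => /eqP e'; apply: val_inj => /=.
  rewrite e' -(ord_digit a0) -tnthE // nth_rcons size_tuple ltn_ord //.
have tin : rcons t (phi t) \in rule_table phi by apply/mapP; exists t; rewrite ?mem_enum.
exists (index (rcons t (phi t)) (rule_table phi)); first by rewrite csize_words index_mem.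
rewrite cnth_words ?index_mem // nth_index // (cnth_word a0) ?szt // last eqxx andbT.
apply/allbP => l lr; rewrite (cnth_word a0) ?szt; last by lia.
by rewrite tnthE // ord_digit.
Qed.

Definition st (s : nat) : m.-tuple 'I_k := [tuple ord (digit k s j) | j < m].

Lemma letter_st s j : j < m -> letter a0 (st s) j = ord (digit k s j).
Proof. by move=> jm; rewrite /letter -(tnth_nth a0 _ (Ordinal jm)) tnth_mktuple. Qed.

Lemma st_surj (s : m.-tuple 'I_k) : exists2 c, c < k ^ m & st c = s.
Proof.
have [c ck cs] := wd_surj a0 s; rewrite size_tuple in ck; exists c => //.
apply: eq_from_tnth => j; rewrite tnth_mktuple (tnth_nth a0) -cs nth_wd //.
by rewrite size_tuple.
Qed.

Lemma walk_letter l s t q (i j d : nat) : walk edge l s t q -> i + d <= l ->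
  j + d < m -> letter a0 (q i) (j + d) = letter a0 (q (i + d)) j.
Proof.
move=> [_ _ Eq]; elim: d i j => [|d IHd] i j id jd; first by rewrite !addn0.
have il : i < l by lia.
have /andP[_ /allP/(_ (j + d))] := Eq i il.
rewrite mem_iota addnS => /(_ _)/eqP -> //; last by lia.
by rewrite IHd ?addSnnS //; lia.
Qed.

Lemma relnE l w s t : reln k Fc r tab m l w s t = ((st s, st t) \in rl (wd l w)).
Proof.
apply/exbP/idP => [[z zk /and3P[/allbP zs /allbP zt /allbP zl]]|].
  apply/rlabP; exists (fun i => [tuple ord (digit k z (i + j)) | j < m]).
  have lE i j : j < m ->
      letter a0 [tuple ord (digit k z (i + j)) | j < m] j = ord (digit k z (i + j)).
    by move=> jm; rewrite /letter -(tnth_nth a0 _ (Ordinal jm)) tnth_mktuple.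
  split; first split.
  - by apply: eq_from_tnth => j; rewrite !tnth_mktuple (eqP (zs _ (ltn_ord j))).
  - by rewrite size_wd; apply: eq_from_tnth => j;
      rewrite !tnth_mktuple (eqP (zt _ (ltn_ord j))).
  - rewrite size_wd => i /zl/andP[av _]; apply/andP; split.
      by move: av; rewrite avoidsnE; congr is_true; apply: eq_avoids => j jm; rewrite lE.
    apply/allP => j; rewrite mem_iota => jm.
    by rewrite !lE ?addSnnS ?addnS //; lia.
  - move=> i a; rewrite size_wd => il; have /andP[_] := zl i il.
    rewrite labnE => /eqP e; rewrite (set_nth_default a0) ?size_wd // nth_wd //.
    apply: val_inj => /=; rewrite ord_digit -e; congr (nat_of_ord (phi _)).
    apply: eq_from_tnth => j; rewrite !tnth_mktuple lE //.
    by have := ltn_ord j; have := r_le_m; lia.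
move=> /rlabP[q [wq lq]]; rewrite size_wd in wq lq.
have [q0 ql Eq] := wq.
(* The first letters of the successive vertices, followed by the whole last vertex, spell the
   walk. *)
pose c i := if i < l then letter a0 (q i) 0 else letter a0 (q l) (i - l).
exists (enc k (fun i => c i) (l + m)).
  by apply: (ltn_enc k_gt0) => i _; exact: ltn_ord.
have m0 : 0 < m by rewrite /m addSn.
have dE i j : i <= l -> j < m ->
    digit k (enc k (fun i => c i) (l + m)) (i + j) = letter a0 (q i) j.
  move=> il jm; rewrite (digit_enc k_gt0 (fun x _ => ltn_ord (c x))); last by lia.
  congr nat_of_ord; rewrite /c; case: ltnP => ijl.
    by rewrite -(walk_letter wq) //; lia.
  have -> : j = (i + j - l) + (l - i) by lia.
  by rewrite (walk_letter wq); [rewrite subnKC //; congr letter; lia|lia|lia].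
apply/and3P; split; apply/allbP => i im.
- by rewrite -[i]add0n dE // q0 letter_st // ord_digit.
- by rewrite dE // ql letter_st // ord_digit.
rewrite avoidsnE labnE; apply/andP; split.
  have /andP[av _] := Eq i im; move: av; congr is_true; apply: eq_avoids => j jm.
  by rewrite dE ?ord_val // ltnW.
apply/eqP; have := lq i a0 im; rewrite nth_wd // => /(congr1 val) /= e.
rewrite -(ord_digit a0) -e; congr (nat_of_ord (phi _)).
apply: eq_from_tnth => j; rewrite !tnth_mktuple dE ?ord_val //; first exact: ltnW.
by have := ltn_ord j; have := r_le_m; lia.
Qed.

Lemma inhabnE l w : inhabn k Fc r tab m l w = inhab (rl (wd l w)).
Proof.
apply/exbP/inhabP => [[s _ /exbP[t _]]|[s [t]]].
  by rewrite relnE => h; exists (st s), (st t).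
have [c ck <-] := st_surj s; have [d dk <-] := st_surj t => h.
by exists c => //; apply/exbP; exists d => //; rewrite relnE.
Qed.

Lemma goodnE l u : u < k ^ l ->
  goodn k Fc r tab m l u = good_word edge label (wd l u).
Proof.
move=> uk; rewrite /goodn /good_word size_wd inhabnE; congr [&& _, _ & _].
rewrite /idem_word -rlab_cat -wd_cat //; apply/allbP/eqP => [h|e s sk].
  apply/setP => -[s t]; have [c ck <-] := st_surj s; have [d dk <-] := st_surj t.
  have /allbP/(_ d dk) := h c ck; rewrite !relnE.
  by do 2![case: (_ \in _)].
by apply/allbP => t tk; rewrite !relnE e.
Qed.

Definition state_code (s : m.-tuple 'I_k) : nat := enc k (fun i => nth a0 s i) m.

Lemma ltn_state_code s : state_code s < k ^ m.
Proof. by apply: ltn_enc => // i _; exact: ltn_ord. Qed.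

Lemma state_codeK s : st (state_code s) = s.
Proof.
apply: eq_from_tnth => j; rewrite tnth_mktuple (tnth_nth a0).
by rewrite (digit_enc k_gt0 (fun x _ => ltn_ord (nth a0 s x))) // ord_val.
Qed.

Lemma critnE P : critn k Fc r tab m P <-> exists G, section_table edge label P G.
Proof.
split=> [/exbP[Gn _ /andP[/allbP h1 /allbP h2]]|[G [h1 h2]]].
  exists (fun w => st (lookup k m P Gn (size w) (word_code w))).
  split=> [u w v gu gv uP wP vP iuwv|a w g1 g2 wP].
    have cuv : wd (size u + (size w + size v)) (catn k (size u) (word_code u)
        (catn k (size w) (word_code w) (word_code v))) = u ++ w ++ v.
      by rewrite !wd_cat ?ltn_word_code // !word_codeK.
    have /allbP/(_ _ (ltn_word_code a0 u)) := h1 (size u) uP.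
    move=> /allbP/(_ (size v) vP)/allbP/(_ _ (ltn_word_code a0 v)).
    move=> /allbP/(_ (size w) wP)/allbP/(_ _ (ltn_word_code a0 w)).
    rewrite !goodnE ?ltn_word_code // inhabnE relnE cuv !word_codeK.
    by rewrite gu gv iuwv.
  have /allbP/(_ _ (ltn_word_code a0 w)) := h2 (size w) wP.
  move=> /allbP/(_ a (ltn_ord a)).
  have c1 : wd (size w).+1 (catn k 1 a (word_code w)) = a :: w.
    by rewrite -add1n wd_cat ?expn1 // wd1 // ord_val word_codeK.
  have c2 : wd (size w).+1 (catn k (size w) (word_code w) a) = rcons w a.
    by rewrite -addn1 wd_cat ?ltn_word_code // wd1 // ord_val word_codeK cats1.
  have l1 : catn k 1 a (word_code w) < k ^ (size w).+1.
    by rewrite -[X in k ^ X]add1n; apply: ltn_catn; rewrite ?expn1 ?ltn_word_code.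
  have l2 : catn k (size w) (word_code w) a < k ^ (size w).+1.
    by rewrite -[X in k ^ X]addn1; apply: ltn_catn; rewrite ?expn1 ?ltn_word_code.
  have e1 : word_code (a :: w) = catn k 1 a (word_code w) by rewrite -c1 wdK.
  have e2 : word_code (rcons w a) = catn k (size w) (word_code w) a by rewrite -c2 wdK.
  rewrite !goodnE // c1 c2 g1 g2 relnE wd1 // ord_val rlab1 e1 e2 size_rcons.
  exact.
(* Inverse of the indexing in [lookup]: the remainder is the length, the quotient the number of the
   word. *)
pose phiG i := state_code (G (wd (i %% P.+1) (i %/ P.+1))).
pose Gn := enc (k ^ m) phiG (k ^ P * P.+1).
have phik i : i < k ^ P * P.+1 -> phiG i < k ^ m by move=> _; exact: ltn_state_code.
have km0 : 0 < k ^ m by rewrite expn_gt0 k_gt0.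
have lE l u : l <= P -> u < k ^ l -> st (lookup k m P Gn l u) = G (wd l u).
  move=> lP ul; rewrite /lookup /Gn digit_enc //.
    by rewrite /phiG modnMDl divnMDl // modn_small // divn_small // addn0 state_codeK.
  have uP : u.+1 <= k ^ P by apply: leq_trans ul _; rewrite leq_pexp2l.
  have : u.+1 * P.+1 <= k ^ P * P.+1 by rewrite leq_mul2r uP orbT.
  by rewrite mulSn; lia.
apply/exbP; exists Gn; first exact: ltn_enc.
apply/andP; split; apply/allbP.
  move=> lu luP; apply/allbP => u uk; apply/allbP => lv lvP; apply/allbP => v vk.
  apply/allbP => lw lwP; apply/allbP => w wk.
  rewrite !goodnE // inhabnE relnE !lE // !wd_cat //.
  by apply/implyP => /and3P[gu gv iuwv]; apply: h1 => //; rewrite size_wd.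
move=> l lP; apply/allbP => w wk; apply/allbP => a ak.
have l1 : catn k 1 a w < k ^ l.+1.
  by rewrite -[X in k ^ X]add1n; apply: ltn_catn; rewrite ?expn1.
have l2 : catn k l w a < k ^ l.+1.
  by rewrite -[X in k ^ X]addn1; apply: ltn_catn; rewrite ?expn1.
rewrite !goodnE // relnE !lE // wd1 // rlab1.
rewrite -{1 3}[l.+1]add1n wd_cat ?expn1 // wd1 // -[l.+1]addn1 wd_cat // wd1 // cats1.
by apply/implyP => /andP[g1 g2]; apply: h2 => //; rewrite size_wd.
Qed.

Lemma labn_rule z x o len i c : reads z x o len -> i + (r + r) < len ->
  labn k r tab z i c = (rule a0 m phi (shift (i%:Z + r%:Z - o)%R x) == c :> nat).
Proof.
move=> zx ir; rewrite labnE -[rule _ _ _ _]/(phi _); congr (nat_of_ord (phi _) == c).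
apply: eq_from_tnth => j; rewrite !tnth_mktuple letter_state; last first.
  by have := ltn_ord j; have := r_le_m; lia.
apply: val_inj => /=; rewrite ord_digit /shift zx; last by have := ltn_ord j; lia.
by congr (nat_of_ord (x _)); lia.
Qed.

(** The lower bound on [n] makes the truncated subtractions in [certn] exact and keeps the tested
    digits inside the window. *)
Lemma certnE R Gam n : m + (R + (r + r)) <= n ->
  certn k Fc r tab m R Gam n <->
  certifies a0 F m phi n (table_rule R Gam).
Proof.
move=> mn; set g := table_rule R Gam.
have enc_reads (x : int -> 'I_k) o len :
    reads (enc k (fun j => x (j%:Z - o)%R) len) x o len.
  by move=> j jl; rewrite (digit_enc k_gt0 (fun j _ => ltn_ord _)).
have enc_lt (x : int -> 'I_k) o len : enc k (fun j => x (j%:Z - o)%R) len < k ^ len.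
  by apply: ltn_enc => // j _; exact: ltn_ord.
have avE z x : reads z x (Posz n) (n + n).+1 -> avoidsn k Fc z (n + n).+1 0 =
    avoids (fun j => x (j%:Z - n%:Z)%R) n.*2.+1.
  move=> zx; rewrite avoidsnE addnn; apply: eq_avoids => j jn.
  by apply: val_inj; rewrite /= ord_digit zx ?addnn.
have imgE z x v : reads z x (Posz n) (n + n).+1 ->
    (forall i, i < m -> digit k v i = gamma k Gam R z (n - R + i)) ->
    avoidsn k Fc v m 0 = avoids (fun j => ca g x (Posz j)) m.
  move=> zx vz; rewrite avoidsnE; apply: eq_avoids => j jm.
  apply: val_inj; rewrite /= ord_digit vz // (gammaE a0 _ zx); last by lia.
  by rewrite /ca; congr (nat_of_ord (g (shift _ x))); lia.
pose f := ca (rule a0 m phi).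
have labE z x a : reads z x (Posz n) (n + n).+1 ->
    (forall i, i < (n + n).+1 -> i + (r + r) <= n + n ->
       labn k r tab z i (digit k a i)) <->
    reads a (f x) (Posz n - Posz r)%R ((n + n).+1 - (r + r)).
  move=> zx; split=> h i i1.
    have := h i; rewrite (labn_rule _ zx); last by lia.
    move=> /(_ _ _)/eqP <-; [|lia|lia]; rewrite /f /ca.
    by congr (nat_of_ord (rule _ _ _ (shift _ x))); lia.
  move=> i2; rewrite (labn_rule _ zx); last by lia.
  rewrite h; last by lia.
  by apply/eqP; rewrite /f /ca; congr (nat_of_ord (rule _ _ _ (shift _ x))); lia.
have gamE a y b : reads a y (Posz n - Posz r)%R ((n + n).+1 - (r + r)) ->
    (forall i, i < (n + n).+1 -> i + (r + r + (R + R)) <= n + n ->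
       digit k b i = gamma k Gam R a i) <->
    reads b (ca g y) (Posz n - Posz r - Posz R)%R ((n + n).+1 - (r + r + (R + R))).
  move=> ay; split=> h i i1.
    rewrite h; [|lia|lia]; rewrite (gammaE a0 _ ay); last by lia.
    by rewrite /ca; congr (nat_of_ord (g (shift _ y))); lia.
  move=> i2; rewrite h; last by lia.
  rewrite (gammaE a0 _ ay); last by lia.
  by rewrite /ca; congr (nat_of_ord (g (shift _ y))); lia.
have finE x a b : reads a (f x) (Posz n - Posz r)%R ((n + n).+1 - (r + r)) ->
    reads b (ca g (f x)) (Posz n - Posz r - Posz R)%R
      ((n + n).+1 - (r + r + (R + R))) ->
    labn k r tab b (n - (R + (r + r))) (digit k a (n - r)) =
    (rule a0 m phi (ca g (f x)) == rule a0 m phi x).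
  move=> ax bx; rewrite (labn_rule _ bx); last by lia.
  rewrite ax; last by lia.
  have -> : (Posz (n - (R + (r + r))) + Posz r - (Posz n - Posz r - Posz R))%R = 0%R.
    by lia.
  have -> : (Posz (n - r) - (Posz n - Posz r))%R = 0%R by lia.
  by rewrite shift0 -[f x 0%R]/(rule a0 m phi (shift 0%R x)) shift0.
split=> [/allbP h x ax|h].
  have zx := enc_reads x (Posz n) (n + n).+1; set z := enc _ _ _ in zx.
  have := h z (enc_lt _ _ _); rewrite (avE z x zx) ax /= => /andP[/allbP h1 /allbP h2].
  split.
    set V := enc k (fun i => ca g x (Posz i - 0)%R) m.
    have Vz i : i < m -> digit k V i = gamma k Gam R z (n - R + i).
      move=> im; rewrite /V enc_reads // (gammaE a0 _ zx); last by lia.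
      by rewrite /ca; congr (nat_of_ord (g (shift _ x))); lia.
    rewrite -(imgE z x V zx Vz).
    have /implyP := h1 V (enc_lt _ _ _); apply.
    by apply/allbP => i im; rewrite Vz.
  set a := enc k (fun j => f x (Posz j - (Posz n - Posz r))%R) (n + n).+1.
  have ax' : reads a (f x) (Posz n - Posz r)%R ((n + n).+1 - (r + r)).
    by move=> j jn; apply: enc_reads; lia.
  set b := enc k (fun j =>
    ca g (f x) (Posz j - (Posz n - Posz r - Posz R))%R) (n + n).+1.
  have bx : reads b (ca g (f x)) (Posz n - Posz r - Posz R)%R
      ((n + n).+1 - (r + r + (R + R))).
    by move=> j jn; apply: enc_reads; lia.
  apply/eqP; rewrite -(finE x a b ax' bx).
  have /allbP/(_ b (enc_lt _ _ _))/implyP := h2 a (enc_lt _ _ _); apply.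
  apply/andP; split; apply/allbP => i im; apply/implyP => i2.
    exact: (labE z x a zx).2.
  by apply/eqP; apply: (gamE a (f x) b ax').2.
apply/allbP => z _; apply/implyP.
pose x (i : int) := ord (digit k z (absz (i + Posz n)%R)).
have zx : reads z x (Posz n) (n + n).+1.
  by move=> j _; rewrite /x ord_digit; congr digit; lia.
rewrite (avE z x zx) => ax; have [h1 h2] := h x ax.
apply/andP; split; apply/allbP => a _.
  by apply/implyP => /allbP va; rewrite (imgE z x a zx) // => i im; apply/eqP/va.
apply/allbP => b _; apply/implyP => /andP[/allbP ha /allbP hb].
have ax' : reads a (f x) (Posz n - Posz r)%R ((n + n).+1 - (r + r)).
  by apply/(labE z x a zx) => i im; apply/implyP/ha.
have bx : reads b (ca g (f x)) (Posz n - Posz r - Posz R)%R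
      ((n + n).+1 - (r + r + (R + R))).
  by apply/(gamE a (f x) b ax') => i im i2; apply/eqP; move: i2; apply/implyP/hb.
by rewrite (finE x a b ax' bx) h2.
Qed.

End Specification.

(** * The decision procedure *)

Section Decision.
Variables (k : nat) (F : seq (seq 'I_k)) (r : nat).
Variable phi : {ffun r.*2.+1.-tuple 'I_k -> 'I_k}.

Let Fc := code_words F.
Let tab := code_words (rule_table phi).
Let m := (r + r).+1 + Fc.

Lemma vn_regular_empty (f : End (sft F)) : k = 0 -> vn_regular f.
Proof.
move=> k0; have empty (x : sft F) : False.
  by have := leq_ltn_trans (leq0n _) (ltn_ord (val x 0%R)); rewrite k0.
by exists f; split; apply: End_eq => x; case: (empty x).
Qed.

Lemma certificate_empty c : k = 0 -> certificate k Fc r tab m c.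
Proof.
by move=> k0; do 3![apply/exbP; exists 0 => //]; rewrite /certn /allb k0 exp0n.
Qed.

(** Regularity is semi-decidable. *)
Lemma vn_regular_certificate (f : End (sft F)) : has_local_rule f phi ->
  vn_regular f <-> exists c, certificate k Fc r tab m c.
Proof.
move=> frule; have [k0|k0] := posnP k.
  split=> [_|_]; last exact: vn_regular_empty.
  by exists 0; exact: certificate_empty.
pose a0 := Ordinal k0.
have rm : r.*2.+1 <= m by rewrite /m addnn leq_addr.
have Fm w : w \in F -> size w <= m := fun wF => F_le_m _ wF.
apply: (iff_trans (vn_regularP a0 rm frule)); split=> [[g wg]|[c]].
  have [n0 cert] := regular_certifies rm wg; have [lg _ _] := wg.
  have [R [Gam gE]] := table_rule_surj a0 lg.
  exists (n0 + R + Gam); apply/exbP; exists R; first by lia.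
  apply/exbP; exists Gam; first by lia.
  apply/exbP; exists n0; first by lia.
  apply/(certnE a0); first by lia.
  by rewrite gE; apply: cert; lia.
move=> /exbP[R _ /exbP[Gam _ /exbP[e _ ]]] /(certnE a0) cert.
exists (table_rule a0 R Gam).
apply: certifies_regular (cert _) => //; [exact: locl_table_rule|lia].
Qed.

(** Non-regularity is semi-decidable; mixing enters in the construction of [g] from the tables. *)
Lemma vn_regular_critn (f : End (sft F)) : mixing (sft F) -> has_local_rule f phi ->
  0 < k -> vn_regular f <-> forall P, critn k Fc r tab m P.
Proof.
move=> mixF frule k0; pose a0 := Ordinal k0.
have rm : r.*2.+1 <= m by rewrite /m addnn leq_addr.
have Fm w : w \in F -> size w <= m := fun wF => F_le_m _ wF.
apply: (iff_trans (vn_regularP a0 rm frule)); split=> [[g wg] P|h].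
  by apply/(critnE a0); eexists; exact: (regular_tables rm Fm frule P wg).
apply: (tables_regular rm Fm frule mixF) => P.
by apply/(critnE a0).
Qed.

End Decision.

Theorem mainTheorem2 :
  exists p : recfun 4,
  forall (k : nat) (F : seq (seq 'I_k)) (r : nat)
    (phi : {ffun r.*2.+1.-tuple 'I_k -> 'I_k}) (f : End (sft F)),
  mixing (sft F) -> has_local_rule f phi ->
  decides_at p (instance_code F phi) (vn_regular f).
Proof.
(* Entry 0 is the number searched for; entries 1 to 4 are the alphabet size, the forbidden words,
   the radius and the rule table. The fifth argument is the window length. *)
pose cert rho := certificate (rho 1) (rho 2) (rho 3) (rho 4)
  ((rho 3 + rho 3).+1 + rho 2) (rho 0).
pose crit rho := critn (rho 1) (rho 2) (rho 3) (rho 4)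
  ((rho 3 + rho 3).+1 + rho 2) (rho 0).
have [pcert certP] : decidable 5 cert.
  by rewrite /cert; do ?[rec_step | apply: dec_certificate].
(* [Mu] searches for a zero, hence the outer negation. *)
have [ptest testP] : decidable 5 (fun rho => ~~ (cert rho || ~~ crit rho)).
  by rewrite /cert /crit; do ?[rec_step | apply: dec_certificate | apply: dec_critn].
pose search := Mu ptest.
(* The search stops at a certificate or at a bound without tables; testing its outcome again tells
   which. *)
exists (Comp pcert (fun i : 'I_5 => if unlift ord0 i is Some j then Proj j else search)).
move=> k F r phi f mixF frule.
set v := instance_code F phi.
pose rho0 c i := if i is i'.+1 then nth 0 v i' else c.
have envE c : env 5 (rho0 c) = [tuple of c :: v].
  apply: eq_from_tnth => i; rewrite tnth_env (tnth_nth 0) /=.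
  by case: i => -[|[|[|[|[|]]]]].
pose good c := cert (rho0 c) || ~~ crit (rho0 c).
have ex_good : exists c, good c.
  have [k0|k0] := posnP k.
    have /(vn_regular_certificate frule)[c cc] := vn_regular_empty f k0.
    by exists c; apply/orP; left.
  have [/(vn_regular_certificate frule)[c cc]|nr] := pselect (vn_regular f).
    by exists c; apply/orP; left.
  apply: contrapT => /forallNP nc; apply: nr.
  apply/(vn_regular_critn mixF frule k0) => P.
  by apply: contrapT => /negP nP; apply: (nc P); apply/orP; right.
have [c gc minc] := find_ex_minn ex_good.
have out : computes (Comp pcert
    (fun i : 'I_5 => if unlift ord0 i is Some j then Proj j else search)) v (cert (rho0 c)).
  exists (env 5 (rho0 c)); last exact: certP.
  move=> i; rewrite tnth_env; case: unliftP => [j|] -> /=; first by rewrite (tnth_nth 0).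
  split; first by have := testP (rho0 c); rewrite envE -/(good c) gc.
  move=> i' ic; exists 0; have := testP (rho0 i'); rewrite envE -/(good i').
  by have /negbTE -> : ~~ good i' by apply/negP => /minc; rewrite leqNgt ic.
split=> [reg|nreg].
  (* For a regular automaton every bound has tables, so the search can only have stopped at a
     certificate. *)
  suff cc : cert (rho0 c) by move: out; rewrite cc.
  have [//|nc] := boolP (cert (rho0 c)); exfalso.
  have [k0|k0] := posnP k; first by move/negP: nc; apply; exact: certificate_empty.
  move: gc; rewrite /good (negbTE nc) => /negP; apply.
  exact: (vn_regular_critn mixF frule k0).1.
suff cc : ~~ cert (rho0 c) by move: out; rewrite (negbTE cc).
apply/negP => cc; apply: nreg.
by apply/(vn_regular_certificate frule); exists c.
Qed.
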